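(* Let $c\in[-1,1]$ and $\mu\in\mathcal{M}_{0,c}^3(\mathbb{R}^2)$. Then there exists a constant $C=C(\mu)>0$ such that for every integer $n\ge 1$, $$d_{\mathrm{BB}}\big(\tfrac{1}{\sqrt n}\mu^{\uplus\uplus n},\tilde\gamma_c\big)\le \frac{C}{\sqrt n}.$$ In particular, $\tfrac{1}{\sqrt n}\mu^{\uplus\uplus n}$ converges weakly to $\tilde\gamma_c$ as $n\to\infty$.
   Context: $\mathcal{M}(\mathbb{R}^2)$ is the set of Borel probability measures on $\mathbb{R}^2$; for $\mu$ in it, $\mu^{(1)},\mu^{(2)}$ are its marginals and $m_{k,l}(\mu)=\iint x^ky^l\,d\mu(x,y)$. $\mathcal{M}^3(\mathbb{R}^2)$ is the set of $\mu$ with $\iint|x|^k|y|^l\,d\mu<\infty$ whenever $k+l\le 3$. $\mathcal{M}_{0,c}^3(\mathbb{R}^2)$ is the set of $\mu\in\mathcal{M}^3(\mathbb{R}^2)$ with $m_1(\mu^{(i)})=0$, $m_2(\mu^{(i)})=1$ for $i=1,2$, and $m_{1,1}(\mu)=c$. For $\lambda>0$, $\lambda\mu$ is the dilation $(\lambda\mu)(A)=\mu(A/\lambda)$. For a probability measure $\rho$ on $\mathbb{R}$: $G_\rho(z)=\int\frac{d\rho(t)}{z-t}$, $E_\rho(z)=z-1/G_\rho(z)$ on $\mathbb{C}\setminus\mathbb{R}$. For $\mu\in\mathcal{M}(\mathbb{R}^2)$: $G_\mu(z,w)=\int_{\mathbb{R}^2}\frac{d\mu(s,t)}{(z-s)(w-t)}$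 and the partial self-energy is $$E_\mu(z,w)=\frac1zE_{\mu^{(1)}}(z)+\frac1wE_{\mu^{(2)}}(w)+\frac{G_\mu(z,w)}{G_{\mu^{(1)}}(z)G_{\mu^{(2)}}(w)}-1,\qquad (z,w)\in(\mathbb{C}\setminus\mathbb{R})^2.$$ The bi-Boolean additive convolution $\mu\uplus\uplus\nu$ is the measure characterized by $E_{\mu\uplus\uplus\nu}=E_\mu+E_\nu$; $\mu^{\uplus\uplus n}$ is the $n$-fold convolution. $\tilde\gamma_c$ (standard bi-Boolean Gaussian of covariance $c$) is the measure with $E_{\tilde\gamma_c}(z,w)=\frac1{z^2}+\frac1{w^2}+\frac{c}{zw}$. The domain $\Omega_0$: a truncated Stolz angle is a set $\{x+iy: y<0,\ |x|<-\alpha y,\ y>-\beta\}$ with $\alpha,\beta>0$. A (sufficiently small) truncated Stolz angle $\Delta\subseteq\{|z+i/4|<1/4\}$ is fixed once and for all and $\Omega_0=(\Delta\cup\overline\Delta)\times(\Delta\cup\overline\Delta)$. ($\Delta$ is chosen so that, for every $\mu\in\mathcal{M}^3(\mathbb{R}^2)$ with $m_2(\mu^{(1)}),m_2(\mu^{(2)})\le1$, the bi-free $R$-transform $R_\mu(z,w)=1+zR_{\mu^{(1)}}(z)+wR_{\mu^{(2)}}(w)-zw/G_\mu(R_{\mu^{(1)}}(z)+1/z,R_{\mu^{(2)}}(w)+1/w)$ is analytic on $\Omega_0$, where for a one-dimensional measure $\rho$, $R_\rho$ is the analytic solution of $G_\rho(R_\rho(z)+1/z)=z$; such $\Delta$ exists.)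 For $\mu,\nu\in\mathcal{M}^3(\mathbb{R}^2)$ with marginals of variance $\le1$, $$d_{\mathrm{BB}}(\mu,\nu)=\sup_{(z,w)\in\Omega_0}\frac{|E_\mu(1/z,1/w)-E_\nu(1/z,1/w)|}{\sum_{k+l=3}|z|^k|w|^l},$$ the sum being over integers $k,l\ge0$.
   Formalization: The n-fold bi-Boolean convolution of μ need not exist as a probability measure (e.g. masses 1/2 at (0,1), 1/4 at (±√2,−1), any n≥2); the bound and the weak convergence are stated for those n for which it exists. *)

(* Defs.v *)
From HB Require Import structures.
From mathcomp Require Import all_boot all_order all_algebra.
From mathcomp Require Import complex.
From mathcomp Require Import all_classical all_reals all_analysis.
From mathcomp Require Import measurable_realfun.

Set Implicit Arguments.
Unset Strict Implicit.
Unset Printing Implicit Defensive.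

Import Order.TTheory GRing.Theory Num.Theory.
Import numFieldNormedType.Exports.

Local Open Scope classical_set_scope.
Local Open Scope ring_scope.
Local Open Scope complex_scope.

(* The product sigma-algebra on R * R is the Borel sigma-algebra of the plane. *)
Notation planar_probability R := (probability (R * R)%type R).

Section PlanarMaps.
Context {R : realType}.

Definition plane_fst (p : R * R) : R := p.1.
Definition plane_snd (p : R * R) : R := p.2.
Definition plane_scale (l : R) (p : R * R) : R * R := (l * p.1, l * p.2).

Lemma measurable_plane_fst : measurable_fun setT plane_fst.
Proof. exact: measurable_fst. Qed.

Lemma measurable_plane_snd : measurable_fun setT plane_snd.
Proof. exact: measurable_snd. Qed.

Lemma measurable_plane_scale (l : R) : measurable_fun setT (plane_scale l).
Proof.
apply/measurable_fun_pairP; split.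
- exact: (measurable_funM (measurable_cst l) measurable_plane_fst).
- exact: (measurable_funM (measurable_cst l) measurable_plane_snd).
Qed.

HB.instance Definition _ :=
  isMeasurableFun.Build _ _ _ _ plane_fst measurable_plane_fst.
HB.instance Definition _ :=
  isMeasurableFun.Build _ _ _ _ plane_snd measurable_plane_snd.
HB.instance Definition _ (l : R) :=
  isMeasurableFun.Build _ _ _ _ (plane_scale l) (measurable_plane_scale l).

Definition marginal1 (mu : planar_probability R) : probability R R :=
  distribution mu plane_fst.
Definition marginal2 (mu : planar_probability R) : probability R R :=
  distribution mu plane_snd.

(* For l > 0, the preimage of A under plane_scale l is A / l. *)
Definition dilation (l : R) (mu : planar_probability R) :
    planar_probability R :=
  distribution mu (plane_scale l).

End PlanarMaps.

Section Moments.
Context {R : realType}.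

Definition moment (k : nat) (rho : probability R R) : R :=
  \int[rho]_t (t ^+ k).

Definition joint_moment (k l : nat) (mu : planar_probability R) : R :=
  \int[mu]_p (p.1 ^+ k * p.2 ^+ l).

Definition finite_third_moments (mu : planar_probability R) : Prop :=
  forall k l : nat, (k + l <= 3)%N ->
    (\int[mu]_p (`|p.1| ^+ k * `|p.2| ^+ l)%:E < +oo)%E.

Definition standardized_third_moments (c : R) (mu : planar_probability R) :
    Prop :=
  [/\ finite_third_moments mu,
      moment 1 (marginal1 mu) = 0 /\ moment 1 (marginal2 mu) = 0,
      moment 2 (marginal1 mu) = 1 /\ moment 2 (marginal2 mu) = 1
    & joint_moment 1 1 mu = c].

End Moments.

Section Transforms.
Context {R : realType}.

Definition Cintegral d (T : measurableType d) (mu : {measure set T -> \bar R})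
    (f : T -> R[i]) : R[i] :=
  (\int[mu]_x complex.Re (f x)) +i* (\int[mu]_x complex.Im (f x)).

(* The transforms below are only meaningful at nonreal arguments. *)
Definition nonreal (z : R[i]) : Prop := complex.Im z != 0.

Definition cauchy (rho : probability R R) (z : R[i]) : R[i] :=
  Cintegral rho (fun t => (z - t%:C)^-1).

Definition self_energy (rho : probability R R) (z : R[i]) : R[i] :=
  z - (cauchy rho z)^-1.

Definition cauchy2 (mu : planar_probability R) (z w : R[i]) : R[i] :=
  Cintegral mu (fun p => ((z - p.1%:C) * (w - p.2%:C))^-1).

Definition partial_self_energy (mu : planar_probability R) (z w : R[i]) :
    R[i] :=
  z^-1 * self_energy (marginal1 mu) z + w^-1 * self_energy (marginal2 mu) w
  + cauchy2 mu z w / (cauchy (marginal1 mu) z * cauchy (marginal2 mu) w) - 1.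

(* [bi_boolean_conv s rho]: rho is the bi-Boolean additive convolution of the
   family s.  It is a relation, not a function: a planar probability measure
   with the prescribed partial self-energy is unique, but need not exist. *)
Definition bi_boolean_conv (s : seq (planar_probability R))
    (rho : planar_probability R) : Prop :=
  forall z w : R[i], nonreal z -> nonreal w ->
    partial_self_energy rho z w = \sum_(mu <- s) partial_self_energy mu z w.

Definition bi_boolean_power (n : nat) (mu rho : planar_probability R) : Prop :=
  bi_boolean_conv (nseq n mu) rho.

Definition bi_boolean_gaussian (c : R) (gamma : planar_probability R) : Prop :=
  forall z w : R[i], nonreal z -> nonreal w ->
    partial_self_energy gamma z w
    = (z ^+ 2)^-1 + (w ^+ 2)^-1 + c%:C / (z * w).

End Transforms.

Section Distance.
Context {R : realType}.

Definition stolz (alpha beta : R) : set R[i] :=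
  [set z | [/\ complex.Im z < 0,
               `|complex.Re z| < - alpha * complex.Im z
             & - beta < complex.Im z]].

Definition stolz_disc : set R[i] :=
  [set z | Normc.normc (z + (0 +i* 4^-1)) < 4^-1].

Definition stolz_sym (alpha beta : R) : set R[i] :=
  stolz alpha beta `|` [set conjc z | z in stolz alpha beta].

Definition Omega0 (alpha beta : R) : set (R[i] * R[i]) :=
  stolz_sym alpha beta `*` stolz_sym alpha beta.

Definition dBB (alpha beta : R) (mu nu : planar_probability R) : \bar R :=
  ereal_sup
    [set (Normc.normc (partial_self_energy mu zw.1^-1 zw.2^-1
                       - partial_self_energy nu zw.1^-1 zw.2^-1)
          / \sum_(k < 4) (Normc.normc zw.1 ^+ k
                          * Normc.normc zw.2 ^+ (3 - k)%N))%:E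
    | zw in Omega0 alpha beta].

End Distance.

Definition weakly_cvg (R : realType) (F : set_system nat)
    (nu : nat -> planar_probability R) (gamma : planar_probability R) : Prop :=
  forall f : R * R -> R, continuous f ->
    (exists M : R, forall p, `|f p| <= M) ->
    (fun n => \int[nu n]_p f p) @ F --> \int[gamma]_p f p.

(* Main.v *)
(* Idea.  Write G1, G2, G for the one- and two-dimensional Cauchy transforms of
   mu and put a = z G1(z) - 1, b = w G2(w) - 1, d = z w G(z,w) - 1 - a - b, the
   last being the integral of s t / ((z - s)(w - t)).  Then
     E_mu(z,w) = a / (1 + a) + b / (1 + b) + (d - a b) / ((1 + a)(1 + b)),
   and expanding the resolvents once more with vanishing means, unit variances
   and covariance c gives
     E_mu(z,w) = z^-2 + w^-2 + c / (z w) + O(sum_k |z|^-k |w|^-(3-k))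
   in nontangential cones with |Im| >= 2.  Points of the truncated Stolz angle
   have such inverses, and the dilation replaces (z,w) by (sqrt n z, sqrt n w),
   so that the n-fold sum has error O(n / sqrt n ^ 3).

   For the weak convergence, letting w = i y tend to infinity in E(z,w) isolates
   the marginal term E_1(z) / z; hence the marginal Cauchy transforms converge,
   and then so does G(z,w), at all nonreal z,
     w.  Combinations of values of G are
   the integrals of products of Poisson kernels, and a compactly supported
   continuous function is uniformly close to its Poisson smoothing.  A cutoff
   function, whose integrals converge as well, rules out escape of mass. *)

Require Import Defs.
From HB Require Import structures.
From mathcomp Require Import all_boot all_order all_algebra.
From mathcomp Require Import complex.
From mathcomp Require Import all_classical all_reals all_analysis.
From mathcomp Require Import measurable_realfun ring lra.

Set Implicit Arguments.
Unset Strict Implicit.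
Unset Printing Implicit Defensive.

Import Order.TTheory GRing.Theory Num.Theory.
Import numFieldNormedType.Exports.
Local Open Scope classical_set_scope.
Local Open Scope ring_scope.
Local Open Scope complex_scope.

(* The topology library has another [cauchy]. *)
Local Notation cauchy := Defs.cauchy.

(** * The modulus on R[i] and elementary resolvent bounds *)

Section ComplexNorm.
Context {R : realType}.
Implicit Types z w : R[i].
Local Notation Re := (@complex.Re _).
Local Notation Im := (@complex.Im _).
Local Notation normc := Normc.normc.

(** The weak limit is not read off from the [dBB] bound: that bound sees only points of [Omega0],
    and reaching all nonreal pairs from there would call for analytic continuation. Instead the
    expansion is proved with a constant depending on [mu] and on the aperture K of a cone, so that
    one estimate serves both conclusions. On the Stolz angle its condition sqrt n |Im| >= 2 holds
    from n = 1 on; at a fixed nonreal pair it holds once n is large.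

    The same estimate gives access to the marginals. Along w = i y its right-hand side is bounded
    uniformly in y >= 1, so y may tend to infinity first, with n fixed, and n afterwards.

    The limits are proved for an arbitrary sequence of measures obeying the rate. The constant
    sequence [gamma] obeys it with zero error, so the marginal self-energies of [gamma] come out of
    the same lemmas, and the two sides can be compared without computing any density. *)

Lemma normc_sqrtE z : normc z = Num.sqrt (Re z ^+ 2 + Im z ^+ 2).
Proof. by case: z. Qed.

Lemma normc_ge0 z : 0 <= normc z.
Proof. by rewrite normc_sqrtE sqrtr_ge0. Qed.

Lemma normc_sqrE z : normc z ^+ 2 = Re z ^+ 2 + Im z ^+ 2.
Proof. by rewrite normc_sqrtE sqr_sqrtr// addr_ge0 ?sqr_ge0. Qed.

Lemma normr_Re_le z : `|Re z| <= normc z.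
Proof. by rewrite normc_sqrtE -sqrtr_sqr ler_wsqrtr// lerDl sqr_ge0. Qed.

Lemma normr_Im_le z : `|Im z| <= normc z.
Proof. by rewrite normc_sqrtE -sqrtr_sqr ler_wsqrtr// lerDr sqr_ge0. Qed.

Lemma normc_le_ReIm z : normc z <= `|Re z| + `|Im z|.
Proof.
rewrite -(@ler_pXn2r _ 2)// ?nnegrE ?normc_ge0 ?addr_ge0// normc_sqrE.
rewrite -[Re z ^+ 2]real_normK ?num_real// -[Im z ^+ 2]real_normK ?num_real//.
by rewrite sqrrD lerD2r lerDl mulrn_wge0// mulr_ge0.
Qed.

Lemma normc_gt0 z : (0 < normc z) = (z != 0).
Proof.
rewrite lt_def normc_ge0 andbT; congr (~~ _).
by apply/eqP/eqP => [/Normc.eq0_normc//|->]; exact: Normc.normc0.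
Qed.

Lemma normcD_le z w : normc (z + w) <= normc z + normc w.
Proof. exact: le_normcD. Qed.

Lemma normc_opp z : normc (- z) = normc z.
Proof. exact: normcN. Qed.

Lemma normcB_le z w : normc (z - w) <= normc z + normc w.
Proof. by rewrite -(normc_opp w) normcD_le. Qed.

Lemma normcX z n : normc (z ^+ n) = normc z ^+ n.
Proof.
elim: n => [|n IHn]; first by rewrite !expr0 Normc.normc1.
by rewrite !exprS Normc.normcM IHn.
Qed.

Lemma normc_real (x : R) : normc x%:C = `|x|.
Proof. by rewrite normc_sqrtE/= expr0n/= addr0 sqrtr_sqr. Qed.

Lemma cReD z w : Re (z + w) = Re z + Re w. Proof. by case: z w => [a b] []. Qed.
Lemma cImD z w : Im (z + w) = Im z + Im w. Proof. by case: z w => [a b] []. Qed.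
Lemma cReN z : Re (- z) = - Re z. Proof. by case: z. Qed.
Lemma cImN z : Im (- z) = - Im z. Proof. by case: z. Qed.
Lemma cReM z w : Re (z * w) = Re z * Re w - Im z * Im w.
Proof. by case: z w => [a b] []. Qed.
Lemma cImM z w : Im (z * w) = Re z * Im w + Im z * Re w.
Proof. by case: z w => [a b] []. Qed.
Lemma cReV z : Re z^-1 = Re z / (Re z ^+ 2 + Im z ^+ 2).
Proof. by case: z. Qed.
Lemma cImV z : Im z^-1 = - (Im z / (Re z ^+ 2 + Im z ^+ 2)).
Proof. by case: z. Qed.

Lemma nonreal_neq0 z : nonreal z -> z != 0.
Proof. by apply: contraNneq => ->. Qed.

Lemma nonreal_sub z (t : R) : nonreal z -> nonreal (z - t%:C).
Proof. by rewrite /nonreal cImD cImN/= subr0. Qed.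

Lemma nonreal_gt0 z : nonreal z -> 0 < `|Im z|.
Proof. by rewrite normr_gt0. Qed.

Lemma nonrealV z : nonreal z -> nonreal z^-1.
Proof.
move=> nz; rewrite /nonreal cImV oppr_eq0 mulf_neq0// invr_neq0//.
by rewrite -normc_sqrE expf_neq0// gt_eqF// normc_gt0 nonreal_neq0.
Qed.

Lemma nonreal_scale (l : R) z : l != 0 -> nonreal z -> nonreal (l%:C * z).
Proof. by move=> l0 nz; rewrite /nonreal cImM/= mul0r addr0 mulf_neq0. Qed.

Lemma normc_resolvent_le z (t : R) : nonreal z ->
  normc (z - t%:C)^-1 <= `|Im z|^-1.
Proof.
move=> nz; rewrite Normc.normcV lef_pV2 ?posrE ?nonreal_gt0//; last first.
  by rewrite normc_gt0; exact/nonreal_neq0/nonreal_sub.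
have -> : Im z = Im (z - t%:C) by rewrite cImD cImN/= subr0.
exact: normr_Im_le.
Qed.

End ComplexNorm.

(** * Integrals of complex-valued functions *)

Section ComplexIntegral.
Context {d} {T : measurableType d} {R : realType}.
Local Notation Re := (@complex.Re _).
Local Notation Im := (@complex.Im _).
Local Notation normc := Normc.normc.
Implicit Types (f g : T -> R[i]) (mu : {measure set T -> \bar R}).

Definition Cmeasurable f :=
  measurable_fun setT (Re \o f) /\ measurable_fun setT (Im \o f).

Definition Cintegrable mu f :=
  mu.-integrable setT (EFin \o (Re \o f)) /\
  mu.-integrable setT (EFin \o (Im \o f)).

(** Inversion is continuous only off the origin, so the line is split into the open complement of 0
    and a singleton, where every function is measurable. *)
Lemma measurable_inv : measurable_fun setT (@GRing.inv R).
Proof.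
rewrite -(setvU [set 0 : R]); apply/measurable_funU => //.
  exact: measurableC.
split; last exact: measurable_fun_set1.
apply: open_continuous_measurable_fun.
  by apply: closed_openC; exact: closed_eq.
by move=> x /[!inE] /= /eqP x0; exact: inv_continuous.
Qed.

Lemma measurable_funV (f : T -> R) :
  measurable_fun setT f -> measurable_fun setT (fun x => (f x)^-1).
Proof. exact: measurableT_comp measurable_inv. Qed.

Lemma Cmeasurable_cst (z : R[i]) : Cmeasurable (fun=> z).
Proof. by split; exact: measurable_cst. Qed.

Lemma Cmeasurable_real (f : T -> R) :
  measurable_fun setT f -> Cmeasurable (fun x => (f x)%:C).
Proof. by move=> mf; split => //=; exact: measurable_cst. Qed.

Lemma CmeasurableD f g :
  Cmeasurable f -> Cmeasurable g -> Cmeasurable (fun x => f x + g x).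
Proof.
move=> [f1 f2] [g1 g2]; split.
- rewrite (_ : _ \o _ = fun x => Re (f x) + Re (g x)).
    exact: measurable_funD.
  by apply/funext => x /=; rewrite cReD.
- rewrite (_ : _ \o _ = fun x => Im (f x) + Im (g x)).
    exact: measurable_funD.
  by apply/funext => x /=; rewrite cImD.
Qed.

Lemma CmeasurableM f g :
  Cmeasurable f -> Cmeasurable g -> Cmeasurable (fun x => f x * g x).
Proof.
move=> [f1 f2] [g1 g2]; split.
- rewrite (_ : _ \o _ = fun x => Re (f x) * Re (g x) - Im (f x) * Im (g x)).
    by apply: measurable_funB; exact: measurable_funM.
  by apply/funext => x /=; rewrite cReM.
- rewrite (_ : _ \o _ = fun x => Re (f x) * Im (g x) + Im (f x) * Re (g x)).
    by apply: measurable_funD; exact: measurable_funM.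
  by apply/funext => x /=; rewrite cImM.
Qed.

Lemma CmeasurableN f : Cmeasurable f -> Cmeasurable (fun x => - f x).
Proof.
move=> mf; rewrite (_ : (fun x => _) = fun x => -1 * f x).
  by apply: CmeasurableM => //; exact: Cmeasurable_cst.
by apply/funext => x; rewrite mulN1r.
Qed.

Lemma CmeasurableB f g :
  Cmeasurable f -> Cmeasurable g -> Cmeasurable (fun x => f x - g x).
Proof. by move=> mf mg; apply: CmeasurableD => //; exact: CmeasurableN. Qed.

Lemma CmeasurableV f : Cmeasurable f -> Cmeasurable (fun x => (f x)^-1).
Proof.
move=> [f1 f2].
have mn : measurable_fun setT (fun x => (Re (f x) ^+ 2 + Im (f x) ^+ 2)^-1).
  by apply: measurable_funV; apply: measurable_funD; exact: measurable_funX.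
split.
- rewrite (_ : _ \o _ = fun x => Re (f x) * (Re (f x) ^+ 2 + Im (f x) ^+ 2)^-1).
    exact: measurable_funM.
  by apply/funext => x /=; rewrite cReV.
- rewrite (_ : _ \o _ =
    fun x => - (Im (f x) * (Re (f x) ^+ 2 + Im (f x) ^+ 2)^-1)).
    by apply: measurableT_comp => //; exact: measurable_funM.
  by apply/funext => x /=; rewrite cImV.
Qed.

Lemma Cintegrable_dom mu f (g : T -> R) : Cmeasurable f ->
  (forall x, normc (f x) <= g x) -> mu.-integrable setT (EFin \o g) ->
  Cintegrable mu f.
Proof.
move=> [f1 f2] fg ig.
split; (apply: le_integrable ig => //; first exact/measurable_EFinP).
- move=> x _ /=; rewrite lee_fin (le_trans (normr_Re_le _))//.
  by rewrite (le_trans (fg x))// ler_norm.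
- move=> x _ /=; rewrite lee_fin (le_trans (normr_Im_le _))//.
  by rewrite (le_trans (fg x))// ler_norm.
Qed.

Lemma CintegrableD mu f g : Cintegrable mu f -> Cintegrable mu g ->
  Cintegrable mu (fun x => f x + g x).
Proof.
move=> [f1 f2] [g1 g2]; split.
- apply: eq_integrable (integrableD _ f1 g1) => // x _ /=.
  by rewrite cReD EFinD.
- apply: eq_integrable (integrableD _ f2 g2) => // x _ /=.
  by rewrite cImD EFinD.
Qed.

Lemma CintegrableZl mu (k : R[i]) f : Cintegrable mu f ->
  Cintegrable mu (fun x => k * f x).
Proof.
move=> [f1 f2]; split.
- apply: eq_integrable (integrableB _ (integrableZl _ (Re k) f1)
    (integrableZl _ (Im k) f2)) => // x _ /=.
  by rewrite cReM EFinB.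
- apply: eq_integrable (integrableD _ (integrableZl _ (Re k) f2)
    (integrableZl _ (Im k) f1)) => // x _ /=.
  by rewrite cImM EFinD.
Qed.

Lemma CintegrableB mu f g : Cintegrable mu f -> Cintegrable mu g ->
  Cintegrable mu (fun x => f x - g x).
Proof.
move=> fi gi; rewrite (_ : (fun x => _) = fun x => f x + -1 * g x).
  by apply: CintegrableD => //; exact: CintegrableZl.
by apply/funext => x; rewrite mulN1r.
Qed.

Lemma eq_Cintegral mu f g : f =1 g -> Cintegral mu f = Cintegral mu g.
Proof. by move=> /funext ->. Qed.

Lemma CintegralD mu f g : Cintegrable mu f -> Cintegrable mu g ->
  Cintegral mu (fun x => f x + g x) = Cintegral mu f + Cintegral mu g.
Proof.
move=> [f1 f2] [g1 g2]; rewrite /Cintegral; congr (_ +i* _).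
- by rewrite -RintegralD//; apply: eq_Rintegral => x _; rewrite cReD.
- by rewrite -RintegralD//; apply: eq_Rintegral => x _; rewrite cImD.
Qed.

Lemma CintegralZl mu (k : R[i]) f : Cintegrable mu f ->
  Cintegral mu (fun x => k * f x) = k * Cintegral mu f.
Proof.
move=> [f1 f2]; apply/eqP; rewrite eq_complex; apply/andP; split; apply/eqP.
- rewrite cReM/= -!RintegralZl// -RintegralB//.
  + by apply: eq_Rintegral => x _; rewrite cReM.
  + exact: (integrableZl _ (Re k) f1).
  + exact: (integrableZl _ (Im k) f2).
- rewrite cImM/= -!RintegralZl// -RintegralD//.
  + by apply: eq_Rintegral => x _; rewrite cImM.
  + exact: (integrableZl _ (Re k) f2).
  + exact: (integrableZl _ (Im k) f1).
Qed.

Lemma CintegralB mu f g : Cintegrable mu f -> Cintegrable mu g ->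
  Cintegral mu (fun x => f x - g x) = Cintegral mu f - Cintegral mu g.
Proof.
move=> fi gi; rewrite -[- Cintegral mu g]mulN1r -CintegralZl// -CintegralD//.
  by apply: eq_Cintegral => x; rewrite mulN1r.
exact: CintegrableZl.
Qed.

Lemma Cintegrable_real mu (f : T -> R) : mu.-integrable setT (EFin \o f) ->
  Cintegrable mu (fun x => (f x)%:C).
Proof.
by move=> fi; split => //; apply: eq_integrable (integrable0 _ _) => //.
Qed.

Lemma Cintegral_real mu (f : T -> R) :
  Cintegral mu (fun x => (f x)%:C) = (\int[mu]_x f x)%:C.
Proof. by rewrite /Cintegral/= /Rintegral integral0. Qed.

(* Multiplying [f] by the conjugate of its integral makes the integral real. *)
Lemma normc_Cintegral_le mu f (g : T -> R) : Cintegrable mu f ->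
  (forall x, normc (f x) <= g x) -> mu.-integrable setT (EFin \o g) ->
  normc (Cintegral mu f) <= \int[mu]_x g x.
Proof.
move=> fi fg ig; set I := Cintegral mu f.
have [->|I0] := eqVneq I 0.
  by rewrite Normc.normc0 Rintegral_ge0// => x _;
    exact: le_trans (normc_ge0 _) (fg x).
rewrite -(ler_pM2l (_ : 0 < normc I)) ?normc_gt0//.
have -> : normc I * normc I = Re (conjc I * I).
  by rewrite -expr2 normc_sqrE cReM; case: (I) => a b /=; ring.
rewrite -CintegralZl//= -RintegralZl//.
have [h1 _] := CintegrableZl (conjc I) fi.
apply: le_Rintegral => //; first exact: (integrableZl _ (normc I) ig).
move=> x _; apply: le_trans (ler_norm _) (le_trans (normr_Re_le _) _).
rewrite Normc.normcM ler_pM ?normc_ge0//.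
by rewrite !normc_sqrtE; case: (I) => a b /=; rewrite sqrrN.
Qed.

End ComplexIntegral.

(** * Integration against a probability and its image measures *)

Section ProbabilityIntegral.
Context {d} {T : measurableType d} {R : realType} (P : probability T R).
Local Notation normc := Normc.normc.

Lemma integrable_bounded (f : T -> R) (M : R) : measurable_fun setT f ->
  (forall x, `|f x| <= M) -> P.-integrable setT (EFin \o f).
Proof.
move=> mf fM; apply: (le_integrable measurableT (g := EFin \o cst M)) => //.
- exact/measurable_EFinP.
- by move=> x _ /=; rewrite lee_fin (le_trans (fM x))// ler_norm.
- by apply: finite_measure_integrable_cst.
Qed.

Lemma Rintegral_probability_cst (k : R) : \int[P]_x k = k.
Proof. by rewrite Rintegral_cst//= probability_setT/= mulr1. Qed.

Lemma Cintegrable_bounded (f : T -> R[i]) (M : R) : Cmeasurable f ->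
  (forall x, normc (f x) <= M) -> Cintegrable P f.
Proof.
move=> mf fM; apply: Cintegrable_dom fM _ => //.
by apply: finite_measure_integrable_cst.
Qed.

Lemma Cintegrable_cst (z : R[i]) : Cintegrable P (fun=> z).
Proof. by apply: (@Cintegrable_bounded _ (normc z)) => //;
  exact: Cmeasurable_cst. Qed.

Lemma Cintegral_cst (z : R[i]) : Cintegral P (fun=> z) = z.
Proof. by rewrite /Cintegral !Rintegral_probability_cst; case: z. Qed.

Lemma Cintegral_distribution d' (T' : measurableType d')
    (X : {mfun T >-> T'}) (f : T' -> R[i]) :
  Cmeasurable f -> Cintegrable P (f \o X) ->
  Cintegral (distribution P X) f = Cintegral P (f \o X).
Proof.
move=> [f1 f2] [i1 i2]; rewrite /Cintegral /Rintegral.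
by rewrite !integral_distribution//; exact/measurable_EFinP.
Qed.

Lemma Rintegral_distribution d' (T' : measurableType d')
    (X : {mfun T >-> T'}) (f : T' -> R) :
  measurable_fun setT f -> P.-integrable setT (EFin \o (f \o X)) ->
  \int[distribution P X]_y f y = \int[P]_x f (X x).
Proof.
move=> mf fi; rewrite /Rintegral.
by rewrite integral_distribution//; exact/measurable_EFinP.
Qed.

End ProbabilityIntegral.

(** * Expansion of resolvent integrals at infinity *)

Section ResolventExpansion.
Context {d} {T : measurableType d} {R : realType} (P : probability T R).
Local Notation Re := (@complex.Re _).
Local Notation Im := (@complex.Im _).
Local Notation normc := Normc.normc.
Local Notation resolvent z X := (fun x => (z - (X x)%:C)^-1).

Lemma Cmeasurable_resolvent (X : T -> R) (z : R[i]) : measurable_fun setT X ->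
  Cmeasurable (resolvent z X).
Proof.
move=> mX; apply: CmeasurableV; apply: CmeasurableB.
  exact: Cmeasurable_cst.
exact: Cmeasurable_real.
Qed.

Lemma Cintegrable_resolvent (X : T -> R) (z : R[i]) : measurable_fun setT X ->
  nonreal z -> Cintegrable P (resolvent z X).
Proof.
move=> mX nz; apply: (@Cintegrable_bounded _ _ _ _ _ `|Im z|^-1).
  exact: Cmeasurable_resolvent.
by move=> x; exact: normc_resolvent_le.
Qed.

Lemma Cintegrable_resolventM (X Y : T -> R) (z w : R[i]) :
  measurable_fun setT X -> measurable_fun setT Y -> nonreal z -> nonreal w ->
  Cintegrable P (fun x => (z - (X x)%:C)^-1 * (w - (Y x)%:C)^-1).
Proof.
move=> mX mY nz nw.
apply: (@Cintegrable_bounded _ _ _ _ _ (`|Im z|^-1 * `|Im w|^-1)).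
  by apply: CmeasurableM; exact: Cmeasurable_resolvent.
by move=> x; rewrite Normc.normcM ler_pM ?normc_ge0 ?normc_resolvent_le.
Qed.

Section OneVariable.
Variables (X : T -> R) (z : R[i]).
Hypothesis mX : measurable_fun setT X.
Hypothesis nz : nonreal z.
Hypothesis iX : P.-integrable setT (EFin \o X).
Hypothesis iX2 : P.-integrable setT (EFin \o (fun x => X x ^+ 2)).
Hypothesis iX3 : P.-integrable setT (EFin \o (fun x => `|X x| ^+ 3)).
Hypothesis EX : \int[P]_x X x = 0.
Hypothesis EX2 : \int[P]_x (X x ^+ 2) = 1.

Let z0 : z != 0. Proof. exact: nonreal_neq0. Qed.

Let zX0 x : z - (X x)%:C != 0.
Proof. exact/nonreal_neq0/nonreal_sub. Qed.

(** From z/(z - t) = 1 + t/z + t^2/(z (z - t)): the linear term integrates to 0 because the mean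
    vanishes. *)
Lemma resolvent_first_order :
  z * Cintegral P (resolvent z X) - 1
  = Cintegral P (fun x => z^-1 * (X x ^+ 2)%:C * (z - (X x)%:C)^-1).
Proof.
have -> : 1 = Cintegral P (fun x => 1 + z^-1 * (X x)%:C) :> R[i].
  rewrite CintegralD; [|exact:
    Cintegrable_cst|exact/CintegrableZl/Cintegrable_real].
  rewrite CintegralZl; last exact: Cintegrable_real.
  by rewrite Cintegral_real EX mulr0 addr0 Cintegral_cst.
rewrite -CintegralZl; last exact: Cintegrable_resolvent.
rewrite -CintegralB.
- apply: eq_Cintegral => x; rewrite rmorphXn/=.
  by field; rewrite z0 zX0.
- exact/CintegrableZl/Cintegrable_resolvent.
- by apply: CintegrableD; [exact:
  Cintegrable_cst|exact/CintegrableZl/Cintegrable_real].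
Qed.

Let Cmeasurable_real_resolvent (f : T -> R)
  (k : R[i]) : measurable_fun setT f ->
  Cmeasurable (fun x => k * (f x)%:C * (z - (X x)%:C)^-1).
Proof.
move=> mf; apply: CmeasurableM; last exact: Cmeasurable_resolvent.
by apply: CmeasurableM; [exact: Cmeasurable_cst|exact: Cmeasurable_real].
Qed.

Let dom (f : T -> R) (k : R[i]) x :
  normc (k * (f x)%:C * (z - (X x)%:C)^-1) <= normc k * `|Im z|^-1 * `|f x|.
Proof.
rewrite !Normc.normcM normc_real [leRHS]mulrAC ler_wpM2l//.
  by rewrite mulr_ge0 ?normc_ge0.
exact: normc_resolvent_le.
Qed.

Let iX3' : P.-integrable setT (EFin \o (fun x => X x ^+ 3)).
Proof.
apply: le_integrable iX3 => //.
  by apply/measurable_EFinP; exact: measurable_funX.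
by move=> x _ /=; rewrite !normrX normr_id.
Qed.

Let iX2' : P.-integrable setT (EFin \o (fun x => `|X x ^+ 2|)).
Proof. exact: integrable_norm. Qed.

Lemma normc_resolvent_first_order :
  normc (z * Cintegral P (resolvent z X) - 1) <= (normc z)^-1 * `|Im z|^-1.
Proof.
rewrite resolvent_first_order.
have ig := integrableZl measurableT ((normc z)^-1 * `|Im z|^-1) iX2'.
apply: le_trans (@normc_Cintegral_le _ _ _ _ _ _ _ (dom (fun x =>
  X x ^+ 2) z^-1) _) _.
- apply: Cintegrable_dom (dom (fun x => X x ^+ 2) z^-1) _.
    by apply: Cmeasurable_real_resolvent; exact: measurable_funX.
  by rewrite Normc.normcV.
- by rewrite Normc.normcV.
- rewrite Normc.normcV RintegralZl//.
  under eq_Rintegral do rewrite ger0_norm ?sqr_ge0//.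
  by rewrite EX2 mulr1.
Qed.

(** One more step, t^2/(z (z - t)) = t^2/z^2 + t^3/(z^2 (z - t)); the unit variance turns the first
    term into z^-2. *)
Lemma resolvent_second_order :
  z * Cintegral P (resolvent z X) - 1 - (z ^+ 2)^-1
  = Cintegral P (fun x => z ^- 2 * (X x ^+ 3)%:C * (z - (X x)%:C)^-1).
Proof.
have E2 : (z ^+ 2)^-1 = Cintegral P (fun x => (z ^- 2) * (X x ^+ 2)%:C).
  rewrite CintegralZl; last exact: Cintegrable_real.
  by rewrite Cintegral_real EX2 mulr1.
rewrite resolvent_first_order {1}E2 -CintegralB.
- apply: eq_Cintegral => x; rewrite !rmorphXn/=.
  by field; rewrite z0 zX0.
- apply: Cintegrable_dom (dom (fun x => X x ^+ 2) z^-1) _.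
    by apply: Cmeasurable_real_resolvent; exact: measurable_funX.
  exact: (integrableZl measurableT _ iX2').
- exact/CintegrableZl/Cintegrable_real.
Qed.

Lemma normc_resolvent_second_order :
  normc (z * Cintegral P (resolvent z X) - 1 - (z ^+ 2)^-1)
  <= (normc z)^-1 ^+ 2 * `|Im z|^-1 * \int[P]_x `|X x| ^+ 3.
Proof.
rewrite resolvent_second_order.
have iX3n : P.-integrable setT (EFin \o (fun x => `|X x ^+ 3|)).
  exact: integrable_norm.
apply: le_trans (@normc_Cintegral_le _ _ _ _ _ _ _ (dom (fun x =>
  X x ^+ 3) (z ^- 2)) _) _.
- apply: Cintegrable_dom (dom (fun x => X x ^+ 3) (z ^- 2)) _.
    by apply: Cmeasurable_real_resolvent; exact: measurable_funX.
  exact: (integrableZl measurableT _ iX3n).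
- exact: (integrableZl measurableT _ iX3n).
- rewrite RintegralZl// Normc.normcV normcX exprVn.
  by under eq_Rintegral do rewrite normrX.
Qed.

End OneVariable.

Section TwoVariables.
Variables (X Y : T -> R) (z w : R[i]).
Hypothesis mX : measurable_fun setT X.
Hypothesis mY : measurable_fun setT Y.
Hypothesis nz : nonreal z.
Hypothesis nw : nonreal w.
Hypothesis iXY : P.-integrable setT (EFin \o (fun x => X x * Y x)).
Hypothesis iX2Y : P.-integrable setT (EFin \o (fun x => `|X x| ^+ 2 * `|Y x|)).
Hypothesis iXY2 : P.-integrable setT (EFin \o (fun x => `|X x| * `|Y x| ^+ 2)).

Let a := z * Cintegral P (resolvent z X) - 1.
Let b := w * Cintegral P (resolvent w Y) - 1.
Let e := z * w * Cintegral P (fun x => (z - (X x)%:C)^-1 * (w - (Y x)%:C)^-1)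
  - 1 - a - b.

(** [e], the d of the overview, is the integral of (z/(z - s) - 1)(w/(w - t) - 1), whose factors are
    s/(z - s) and t/(w - t). *)
Lemma resolvent_covariance :
  e = Cintegral P (fun x => (X x * Y x)%:C * ((z - (X x)%:C)^-1 * (w -
    (Y x)%:C)^-1)).
Proof.
rewrite /e /a /b.
have i1 : Cintegrable P (resolvent z X) by exact: Cintegrable_resolvent.
have i2 : Cintegrable P (resolvent w Y) by exact: Cintegrable_resolvent.
have i3 := Cintegrable_resolventM mX mY nz nw.
transitivity (Cintegral P (fun x =>
  z * w * ((z - (X x)%:C)^-1 * (w - (Y x)%:C)^-1)
   - z * (z - (X x)%:C)^-1 - w * (w - (Y x)%:C)^-1 + 1)).
  rewrite CintegralD; [|by do !apply: CintegrableB;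
    exact: CintegrableZl|exact: Cintegrable_cst].
  rewrite CintegralB; [|by apply: CintegrableB;
    exact: CintegrableZl|exact: CintegrableZl].
  rewrite CintegralB; [|exact: CintegrableZl|exact: CintegrableZl].
  by rewrite !CintegralZl// Cintegral_cst; ring.
apply: eq_Cintegral => x; rewrite rmorphM/=.
by field; apply/andP; split; exact/nonreal_neq0/nonreal_sub.
Qed.

Let Cmeasurable_covariance :
  Cmeasurable (fun x => (X x * Y x)%:C * ((z - (X x)%:C)^-1 * (w -
    (Y x)%:C)^-1)).
Proof.
apply: CmeasurableM; first by apply: Cmeasurable_real; exact: measurable_funM.
by apply: CmeasurableM; exact: Cmeasurable_resolvent.
Qed.

Let dom_covariance x :
  normc ((X x * Y x)%:C * ((z - (X x)%:C)^-1 * (w - (Y x)%:C)^-1))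
  <= `|Im z|^-1 * `|Im w|^-1 * `|X x * Y x|.
Proof.
rewrite 2!Normc.normcM normc_real [leRHS]mulrC ler_wpM2l// ler_pM ?normc_ge0//;
  exact: normc_resolvent_le.
Qed.

Let iXYn : P.-integrable setT (EFin \o (fun x => `|X x * Y x|)).
Proof. exact: integrable_norm. Qed.

Let Cintegrable_covariance : Cintegrable P
  (fun x => (X x * Y x)%:C * ((z - (X x)%:C)^-1 * (w - (Y x)%:C)^-1)).
Proof.
apply: Cintegrable_dom dom_covariance _ => //.
exact: (integrableZl measurableT _ iXYn).
Qed.

Lemma normc_resolvent_covariance :
  normc e <= `|Im z|^-1 * `|Im w|^-1 * \int[P]_x `|X x * Y x|.
Proof.
rewrite resolvent_covariance -RintegralZl//.
apply: normc_Cintegral_le => //; exact: (integrableZl measurableT _ iXYn).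
Qed.

(** The resolvents are replaced by 1/z and 1/w one at a time: 1/((z - s)(w - t)) - 1/(z w) = s/(z (z
    - s)(w - t)) + t/(z w (w - t)). Multiplied by s t, this leaves exactly the mixed moments of
    order (2,1) and (1,2). *)
Lemma normc_resolvent_covariance_second_order :
  normc (e - (\int[P]_x (X x * Y x))%:C / (z * w))
  <= (normc z)^-1 * `|Im z|^-1 * `|Im w|^-1 * (\int[P]_x (`|X x| ^+ 2 * `|Y x|))
   + (normc z)^-1 * (normc w)^-1 * `|Im w|^-1 * (\int[P]_x
     (`|X x| * `|Y x| ^+ 2)).
Proof.
have iz x : z - (X x)%:C != 0 by exact/nonreal_neq0/nonreal_sub.
have iw x : w - (Y x)%:C != 0 by exact/nonreal_neq0/nonreal_sub.
have z0 := nonreal_neq0 nz; have w0 := nonreal_neq0 nw.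
rewrite resolvent_covariance [X in _ - X]mulrC -Cintegral_real.
rewrite -CintegralZl; last exact: Cintegrable_real.
rewrite -CintegralB//; last exact/CintegrableZl/Cintegrable_real.
have j1 := integrableZl measurableT
  ((normc z)^-1 * `|Im z|^-1 * `|Im w|^-1) iX2Y.
have j2 := integrableZl measurableT ((normc z)^-1 *
  (normc w)^-1 * `|Im w|^-1) iXY2.
rewrite -RintegralZl// -[X in _ + X]RintegralZl// -RintegralD//.
apply: normc_Cintegral_le.
- by apply: CintegrableB => //; exact/CintegrableZl/Cintegrable_real.
- move=> x.
  rewrite (_ : _ - _ = z^-1 * (X x ^+ 2 * Y x)%:C * (z - (X x)%:C)^-1 * (w -
    (Y x)%:C)^-1
    + z^-1 * w^-1 * (X x * Y x ^+ 2)%:C * (w - (Y x)%:C)^-1); last first.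
    rewrite !(rmorphM, rmorphXn)/=; field.
    by rewrite z0 w0 iz iw.
  apply: le_trans (normcD_le _ _) _.
  rewrite !Normc.normcM !normc_real (normrM (X x ^+ 2)) (normrM (X x)
    (Y x ^+ 2)) !normrX.
  apply: lerD.
  + rewrite -[leLHS]mulrA [leRHS](_ : _ = normc z^-1 * (`|X x| ^+ 2 * `|Y x|) *
      (`|Im z|^-1 * `|Im w|^-1)); last by rewrite Normc.normcV; ring.
    rewrite ler_wpM2l//; first by rewrite !mulr_ge0 ?normc_ge0 ?sqr_ge0.
    by rewrite ler_pM ?normc_ge0 ?normc_resolvent_le.
  + rewrite [leRHS](_ : _ = normc z^-1 * normc w^-1 * (`|X x| * `|Y x| ^+ 2) *
      `|Im w|^-1); last by rewrite !Normc.normcV; ring.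
    rewrite ler_wpM2l//; first by rewrite !mulr_ge0 ?normc_ge0 ?sqr_ge0.
    exact: normc_resolvent_le.
- exact: (integrableD measurableT j1 j2).
Qed.

End TwoVariables.
End ResolventExpansion.

(** * Cauchy transforms: nonvanishing and behaviour under dilation *)

Section CauchyTransform.
Context {R : realType}.
Local Notation Re := (@complex.Re _).
Local Notation Im := (@complex.Im _).
Local Notation normc := Normc.normc.
Implicit Types (mu : planar_probability R) (z w : R[i]).

(** The imaginary part of the integrand, multiplied by - Im z, is strictly positive at every point,
    and such a function has positive integral under a probability. *)
Lemma Cintegral_resolvent_neq0 d (T : measurableType d) (P : probability T R)
    (X : T -> R) z : measurable_fun setT X -> nonreal z ->
  Cintegral P (fun x => (z - (X x)%:C)^-1) != 0.
Proof.
move=> mX nz; apply/negP => /eqP I0.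
have [_ iI] := Cintegrable_resolvent P mX nz.
have n0 x : Re (z - (X x)%:C) ^+ 2 + Im (z - (X x)%:C) ^+ 2 != 0.
  rewrite -normc_sqrE expf_neq0// gt_eqF// normc_gt0.
  exact/nonreal_neq0/nonreal_sub.
have ImE x : Im (z - (X x)%:C)^-1 * Im z
    = - (Im z ^+ 2 / (Re (z - (X x)%:C) ^+ 2 + Im (z - (X x)%:C) ^+ 2)).
  by rewrite cImV (_ : Im (z - _) = Im z) ?cImD ?cImN/= ?subr0//; ring.
have : \int[P]_x (Im (z - (X x)%:C)^-1 * Im z) = 0.
  rewrite RintegralZr//.
  by have /(congr1 Im) /= -> := I0; rewrite mul0r.
pose f x := Im z ^+ 2 / (Re (z - (X x)%:C) ^+ 2 + Im (z - (X x)%:C) ^+ 2).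
have f0 x : 0 < f x.
  rewrite divr_gt0 ?exprn_even_gt0//= lt_def n0/=.
  by rewrite addr_ge0 ?sqr_ge0.
have fi : P.-integrable setT (EFin \o f).
  apply: eq_integrable (integrableZl measurableT (- Im z) iI) => // x _ /=.
  by rewrite -EFinM mulNr mulrC ImE opprK.
move=> If; have : (\int[P]_x `|(EFin \o f) x| = 0)%E.
  under eq_integral do rewrite /= ger0_norm ?ltW//.
  rewrite -[LHS]fineK ?integrable_fin_num//; congr EFin.
  rewrite -[RHS]oppr0 -If -mulN1r -RintegralZl//.
    by apply: eq_Rintegral => x _; rewrite ImE mulN1r opprK.
  apply: eq_integrable (integrableZl measurableT (Im z) iI) => // x _ /=.
  by rewrite -EFinM mulrC.
have mf : measurable_fun setT (EFin \o f) by case/integrableP : fi.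
(* [f] would vanish almost everywhere; being positive everywhere, it makes the exceptional null set
   the whole space, against P(T) = 1. *)
move=> /(ae_eq_integral_abs P measurableT mf)/=.
case=> N [mN N0 sN].
have NT : N = setT.
  apply/seteqP; split => // x _; apply: sN => /= /(_ I) [] /eqP.
  by rewrite gt_eqF.
move: N0; rewrite NT => N0.
by have /eqP := etrans (esym (probability_setT P)) N0; rewrite onee_eq0.
Qed.

Lemma cauchy_marginal1 mu z : nonreal z ->
  cauchy (marginal1 mu) z = Cintegral mu (fun p => (z - p.1%:C)^-1).
Proof.
move=> nz; rewrite /cauchy Cintegral_distribution//.
  exact: (Cmeasurable_resolvent _ (@measurable_id _ R setT)).
by apply: Cintegrable_resolvent => //; exact: measurable_fst.
Qed.

Lemma cauchy_marginal2 mu z : nonreal z ->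
  cauchy (marginal2 mu) z = Cintegral mu (fun p => (z - p.2%:C)^-1).
Proof.
move=> nz; rewrite /cauchy Cintegral_distribution//.
  exact: (Cmeasurable_resolvent _ (@measurable_id _ R setT)).
by apply: Cintegrable_resolvent => //; exact: measurable_snd.
Qed.

Lemma cauchy2E mu z w : cauchy2 mu z w
  = Cintegral mu (fun p => (z - p.1%:C)^-1 * (w - p.2%:C)^-1).
Proof. by apply: eq_Cintegral => p; rewrite invfM. Qed.

Lemma cauchy_marginal1_neq0 mu z : nonreal z -> cauchy (marginal1 mu) z != 0.
Proof.
move=> nz; rewrite cauchy_marginal1//.
by apply: Cintegral_resolvent_neq0 => //; exact: measurable_fst.
Qed.

Lemma cauchy_marginal2_neq0 mu z : nonreal z -> cauchy (marginal2 mu) z != 0.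
Proof.
move=> nz; rewrite cauchy_marginal2//.
by apply: Cintegral_resolvent_neq0 => //; exact: measurable_snd.
Qed.

Let resolvent_dilation (l t : R) z : l != 0 ->
  (z - (l * t)%:C)^-1 = l^-1%:C * (l^-1%:C * z - t%:C)^-1.
Proof.
move=> l0; have lC : l%:C != 0 :> R[i] by rewrite (inj_eq (@complexI R)).
rewrite fmorphV/= -invfM; congr (_ ^-1).
by rewrite mulrBr mulVKf// rmorphM.
Qed.

Lemma cauchy_dilation1 mu (l : R) z : l != 0 -> nonreal z ->
  cauchy (marginal1 (dilation l mu)) z
  = l^-1%:C * cauchy (marginal1 mu) (l^-1%:C * z).
Proof.
move=> l0 nz; have nlz : nonreal (l^-1%:C * z) by apply: nonreal_scale;
  rewrite ?invr_eq0.
rewrite !cauchy_marginal1// Cintegral_distribution.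
- rewrite -CintegralZl; last by apply: Cintegrable_resolvent => //;
  exact: measurable_fst.
  by apply: eq_Cintegral => p; exact: resolvent_dilation.
- by apply: Cmeasurable_resolvent; exact: measurable_fst.
- apply: (@Cintegrable_resolvent _ _ _ _ (fun p => l * p.1)) => //.
  by apply: measurable_funM => //; exact: measurable_fst.
Qed.

Lemma cauchy_dilation2 mu (l : R) z : l != 0 -> nonreal z ->
  cauchy (marginal2 (dilation l mu)) z
  = l^-1%:C * cauchy (marginal2 mu) (l^-1%:C * z).
Proof.
move=> l0 nz; have nlz : nonreal (l^-1%:C * z) by apply: nonreal_scale;
  rewrite ?invr_eq0.
rewrite !cauchy_marginal2// Cintegral_distribution.
- rewrite -CintegralZl; last by apply: Cintegrable_resolvent => //;
  exact: measurable_snd.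
  by apply: eq_Cintegral => p; exact: resolvent_dilation.
- by apply: Cmeasurable_resolvent; exact: measurable_snd.
- apply: (@Cintegrable_resolvent _ _ _ _ (fun p => l * p.2)) => //.
  by apply: measurable_funM => //; exact: measurable_snd.
Qed.

Lemma cauchy2_dilation mu (l : R) z w : l != 0 -> nonreal z -> nonreal w ->
  cauchy2 (dilation l mu) z w
  = (l^-1%:C) ^+ 2 * cauchy2 mu (l^-1%:C * z) (l^-1%:C * w).
Proof.
move=> l0 nz nw.
have nlz : nonreal (l^-1%:C * z) by apply: nonreal_scale; rewrite ?invr_eq0.
have nlw : nonreal (l^-1%:C * w) by apply: nonreal_scale; rewrite ?invr_eq0.
have m1 : measurable_fun setT (fun p : R * R => p.1) by exact: measurable_fst.
have m2 : measurable_fun setT (fun p : R * R => p.2) by exact: measurable_snd.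
rewrite !cauchy2E Cintegral_distribution.
- rewrite -CintegralZl; last exact: (Cintegrable_resolventM _ m1 m2).
  apply: eq_Cintegral => p /=.
  by rewrite !resolvent_dilation//; ring.
- by apply: CmeasurableM; exact: Cmeasurable_resolvent.
- apply: (@Cintegrable_resolventM _ _ _ _ (fun p => l * p.1) (fun p =>
  l * p.2)) => //.
    by apply: measurable_funM => //; exact: measurable_fst.
  by apply: measurable_funM => //; exact: measurable_snd.
Qed.

(** E depends on the Cauchy transforms only through z G1(z), w G2(w) and z w G(z,w), in which the
    factors 1/l produced by the dilation are absorbed into the rescaled arguments. *)
Lemma partial_self_energy_dilation mu (l : R) z w :
  l != 0 -> nonreal z -> nonreal w ->
  partial_self_energy (dilation l mu) z w
  = partial_self_energy mu (l^-1%:C * z) (l^-1%:C * w).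
Proof.
move=> l0 nz nw; rewrite /partial_self_energy /self_energy.
have l1 : l^-1 != 0 by rewrite invr_eq0.
have lC : l^-1%:C != 0 :> R[i] by rewrite (inj_eq (@complexI R)).
have g1 := cauchy_marginal1_neq0 mu (nonreal_scale l1 nz).
have g2 := cauchy_marginal2_neq0 mu (nonreal_scale l1 nw).
rewrite cauchy_dilation1// cauchy_dilation2// cauchy2_dilation//.
have z0 := nonreal_neq0 nz; have w0 := nonreal_neq0 nw.
move: (l^-1%:C) lC g1 g2 => k k0 g1 g2.
by field; rewrite k0 g1 g2 z0 w0.
Qed.

Lemma partial_self_energyE mu z w : nonreal z -> nonreal w ->
  let a := z * cauchy (marginal1 mu) z - 1 in
  let b := w * cauchy (marginal2 mu) w - 1 in
  let e := z * w * cauchy2 mu z w - 1 - a - b in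
  partial_self_energy mu z w
  = a / (1 + a) + b / (1 + b) + (e - a * b) / ((1 + a) * (1 + b)).
Proof.
move=> nz nw a b e; rewrite /partial_self_energy /self_energy.
have g1 := cauchy_marginal1_neq0 mu nz; have g2 := cauchy_marginal2_neq0 mu nw.
have aE : 1 + a = z * cauchy (marginal1 mu) z by rewrite /a; ring.
have bE : 1 + b = w * cauchy (marginal2 mu) w by rewrite /b; ring.
rewrite aE bE /e /a /b.
have z0 := nonreal_neq0 nz; have w0 := nonreal_neq0 nw.
by field; rewrite g1 g2 z0 w0.
Qed.

End CauchyTransform.

(** * Expansion of the partial self-energy with a third-order remainder *)

Section Expansion.
Context {R : realType}.
Local Notation Re := (@complex.Re _).
Local Notation Im := (@complex.Im _).
Local Notation normc := Normc.normc.
Implicit Types (mu : planar_probability R) (z w : R[i]).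

Lemma integrable_abs_moment mu k l : finite_third_moments mu ->
  (k + l <= 3)%N ->
  mu.-integrable setT (EFin \o (fun p : R * R => `|p.1| ^+ k * `|p.2| ^+ l)).
Proof.
move=> h kl; have m1 : measurable_fun setT (fun p : R * R => `|p.1|).
  by apply: measurableT_comp => //; exact: measurable_fst.
have m2 : measurable_fun setT (fun p : R * R => `|p.2|).
  by apply: measurableT_comp => //; exact: measurable_snd.
apply/integrableP; split.
  by apply/measurable_EFinP; apply: measurable_funM; exact: measurable_funX.
under eq_integral do rewrite /= ger0_norm ?mulr_ge0 ?exprn_ge0//.
exact: h.
Qed.

Lemma integrable_moment mu k l : finite_third_moments mu -> (k + l <= 3)%N ->
  mu.-integrable setT (EFin \o (fun p : R * R => p.1 ^+ k * p.2 ^+ l)).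
Proof.
move=> h kl; apply: le_integrable (integrable_abs_moment h kl) => //.
  apply/measurable_EFinP; apply: measurable_funM; apply: measurable_funX.
    exact: measurable_fst.
  exact: measurable_snd.
move=> p _ /=; rewrite lee_fin.
by rewrite !normrM !normrX !normr_id.
Qed.

Lemma moment_marginal1 mu k : finite_third_moments mu -> (k <= 3)%N ->
  moment k (marginal1 mu) = \int[mu]_p (p.1 ^+ k).
Proof.
move=> h k3; rewrite /moment Rintegral_distribution//.
have hk : (k + 0 <= 3)%N by rewrite addn0.
apply: eq_integrable (integrable_moment h hk) => // p _ /=.
by rewrite mulr1.
Qed.

Lemma moment_marginal2 mu k : finite_third_moments mu -> (k <= 3)%N ->
  moment k (marginal2 mu) = \int[mu]_p (p.2 ^+ k).
Proof.
move=> h k3; rewrite /moment Rintegral_distribution//.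
have hk : (0 + k <= 3)%N by [].
apply: eq_integrable (integrable_moment h hk) => // p _ /=.
by rewrite mul1r.
Qed.

Lemma normc_inv1D_le2 z : normc z <= 2^-1 -> normc
  (1 + z)^-1 <= 2 /\ 1 + z != 0.
Proof.
move=> hz; have h : 2^-1 <= normc (1 + z).
  have := normcB_le (1 + z) z; rewrite addrK Normc.normc1; lra.
have h0 : 0 < normc (1 + z) by lra.
split; last by rewrite -normc_gt0.
by rewrite Normc.normcV -[leRHS]invrK lef_pV2 ?posrE// invr_gt0.
Qed.

(** Pure algebra, with x and y standing for 1/|z| and 1/|w|. As a, b, e have orders x^2, y^2, x y,
    every product left after linearization has total order four; one surplus factor x or y, at most
    1, is dropped. The constant 8 comes from x^2 y, which receives 4 from e a and 4 from a b; the
    other monomials receive 2 each. *)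
Lemma normc_self_energy_remainder_le (a b e u v k : R[i]) (x y A B D K M : R) :
  0 <= x <= 1 -> 0 <= y <= 1 -> 1 <= K -> 1 <= M ->
  normc a <= 2^-1 -> normc b <= 2^-1 ->
  normc a <= K * x ^+ 2 -> normc b <= K * y ^+ 2 ->
  normc e <= K ^+ 2 * M * (x * y) ->
  normc (a - u) <= A -> normc (b - v) <= B -> normc (e - k) <= D ->
  normc (a / (1 + a) + b / (1 + b) + (e - a * b) / ((1 + a) *
    (1 + b)) - u - v - k)
  <= A + B + D + 8 * K ^+ 3 * M * (x ^+ 3 + x ^+ 2 * y + x * y ^+ 2 + y ^+ 3).
Proof.
move=> /andP[x0 x1] /andP[y0 y1] K1 M1 ha2 hb2 ha hb he hA hB hD.
have [hp pa] := normc_inv1D_le2 ha2; have [hq qb] := normc_inv1D_le2 hb2.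
set p := (1 + a)^-1 in hp; set q := (1 + b)^-1 in hq.
(* Linearization by 1 - p = a p and 1 - q = b q, hence 1 - p q = a p q + b q. *)
have -> : a / (1 + a) + b / (1 + b) + (e - a * b) / ((1 + a) *
  (1 + b)) - u - v - k
  = (a - u) + (b - v) + (e - k) - (a ^+ 2 * p + b ^+ 2 * q
    + e * (a * (p * q) + b * q) + a * b * (p * q)).
  by rewrite /p /q; field; rewrite pa qb.
have K0 : 0 <= K by lra.
have M0 : 0 <= M by lra.
apply: le_trans (normcB_le _ _) _; apply: lerD.
  do 2 (apply: le_trans (normcD_le _ _) _; apply: lerD => //).
have KK : K ^+ 2 <= K ^+ 3 by rewrite ler_eXn2l//
  ltr1n || (rewrite exprS ler_peMl ?sqr_ge0).
have hpq : normc (p * q) <= 4.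
  rewrite Normc.normcM (_ : 4 = 2 * 2); last by ring.
  by rewrite ler_pM ?normc_ge0.
have t1 : normc (a ^+ 2 * p) <= 2 * K ^+ 3 * M * x ^+ 3.
  rewrite Normc.normcM normcX.
  apply: (@le_trans _ _ ((K * x ^+ 2) ^+ 2 * 2)).
    by rewrite ler_pM ?normc_ge0 ?exprn_ge0 ?normc_ge0//
      ler_pXn2r ?nnegrE ?normc_ge0// mulr_ge0 ?sqr_ge0.
  rewrite [leLHS](_ : _ = 2 * (K ^+ 2 * (x * x ^+ 3))); last by ring.
  rewrite [leRHS](_ : _ = 2 * (K ^+ 3 * (M * x ^+ 3))); last by ring.
  rewrite ler_pM2l// ler_pM ?sqr_ge0 ?mulr_ge0 ?exprn_ge0//.
  by rewrite ler_wpM2r ?exprn_ge0// (le_trans x1).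
have t2 : normc (b ^+ 2 * q) <= 2 * K ^+ 3 * M * y ^+ 3.
  rewrite Normc.normcM normcX.
  apply: (@le_trans _ _ ((K * y ^+ 2) ^+ 2 * 2)).
    by rewrite ler_pM ?normc_ge0 ?exprn_ge0 ?normc_ge0//
      ler_pXn2r ?nnegrE ?normc_ge0// mulr_ge0 ?sqr_ge0.
  rewrite [leLHS](_ : _ = 2 * (K ^+ 2 * (y * y ^+ 3))); last by ring.
  rewrite [leRHS](_ : _ = 2 * (K ^+ 3 * (M * y ^+ 3))); last by ring.
  rewrite ler_pM2l// ler_pM ?sqr_ge0 ?mulr_ge0 ?exprn_ge0//.
  by rewrite ler_wpM2r ?exprn_ge0// (le_trans y1).
have t3 : normc (e * (a * (p * q) + b * q))
    <= 4 * K ^+ 3 * M * (x ^+ 2 * y) + 2 * K ^+ 3 * M * (x * y ^+ 2).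
  rewrite Normc.normcM.
  apply: (@le_trans _ _ ((K ^+ 2 * M * (x * y)) *
    (K * x ^+ 2 * 4 + K * y ^+ 2 * 2))).
    rewrite ler_pM ?normc_ge0// (le_trans (normcD_le _ _))//.
    rewrite !(Normc.normcM a) (Normc.normcM b) lerD// ler_pM ?normc_ge0//.
  rewrite [leLHS](_ : _ = 4 * K ^+ 3 * M * (x ^+ 2 * y) * x
    + 2 * K ^+ 3 * M * (x * y ^+ 2) * y); last by ring.
  by rewrite lerD// ler_piMr// !mulr_ge0 ?exprn_ge0.
have t4 : normc (a * b * (p * q)) <= 4 * K ^+ 3 * M * (x ^+ 2 * y).
  rewrite Normc.normcM.
  apply: (@le_trans _ _ ((K * x ^+ 2) * (K * y ^+ 2) * 4)).
    by rewrite ler_pM ?normc_ge0// Normc.normcM ler_pM ?normc_ge0.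
  rewrite [leLHS](_ : _ = 4 * (K ^+ 2 * (y * (x ^+ 2 * y)))); last by ring.
  rewrite [leRHS](_ : _ = 4 * (K ^+ 3 * (M * (x ^+ 2 * y)))); last by ring.
  rewrite ler_pM2l// ler_pM ?sqr_ge0 ?mulr_ge0 ?exprn_ge0//.
  by rewrite ler_wpM2r ?mulr_ge0 ?exprn_ge0// (le_trans y1).
have C0 : 0 <= K ^+ 3 * M by rewrite mulr_ge0 ?exprn_ge0.
have X0 : 0 <= K ^+ 3 * M * x ^+ 3 by rewrite mulr_ge0 ?exprn_ge0.
have Y0 : 0 <= K ^+ 3 * M * y ^+ 3 by rewrite mulr_ge0 ?exprn_ge0.
have Z0 : 0 <= K ^+ 3 * M * (x * y ^+ 2) by rewrite !mulr_ge0 ?exprn_ge0.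
have s1 := normcD_le (a ^+ 2 * p + b ^+ 2 * q + e * (a * (p * q) + b * q))
  (a * b * (p * q)).
have s2 := normcD_le (a ^+ 2 * p + b ^+ 2 * q) (e * (a * (p * q) + b * q)).
have s3 := normcD_le (a ^+ 2 * p) (b ^+ 2 * q).
lra.
Qed.

(** Here p and q stand for 1/|Im z| and 1/|Im w|, and the cone condition trades them for K x and K
    y. The three linear errors together add one copy of the sum of monomials to the eight of the
    previous lemma; 16 is a rounding of 9. *)
Lemma normc_self_energy_remainder_le16 (a b e u v k : R[i])
    (x y p q K M i30 i03 i21 i12 i11 : R) :
  0 < x <= 2^-1 -> 0 < y <= 2^-1 -> 0 <= p <= 2^-1 -> 0 <= q <= 2^-1 ->
  p <= K * x -> q <= K * y -> 1 <= K -> 1 <= M ->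
  0 <= i30 <= M -> 0 <= i03 <= M -> 0 <= i21 <= M -> 0 <= i12 <= M ->
  0 <= i11 <= M ->
  normc a <= x * p -> normc b <= y * q -> normc e <= p * q * i11 ->
  normc (a - u) <= x ^+ 2 * p * i30 -> normc (b - v) <= y ^+ 2 * q * i03 ->
  normc (e - k) <= x * p * q * i21 + x * y * q * i12 ->
  normc (a / (1 + a) + b / (1 + b) + (e - a * b) / ((1 + a) *
    (1 + b)) - u - v - k)
  <= 16 * (K ^+ 3 * M) * (x ^+ 3 + x ^+ 2 * y + x * y ^+ 2 + y ^+ 3).
Proof.
move=> /andP[x0 x2] /andP[y0 y2] /andP[p0 p2] /andP[q0 q2] pK qK K1 M1.
move=> /andP[? ?] /andP[? ?] /andP[? ?] /andP[? ?] /andP[? ?] na nb ne ra rb re.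
have K0 : 0 <= K by rewrite (le_trans _ K1).
have x0' := ltW x0; have y0' := ltW y0.
have KK : K <= K ^+ 2 by rewrite expr2 ler_peMl.
have KKK : K ^+ 2 <= K ^+ 3 by rewrite [leRHS]exprS ler_peMl ?sqr_ge0.
have hxp : x * p <= K * x ^+ 2.
  by rewrite expr2 mulrCA ler_wpM2l// ltW.
have hyq : y * q <= K * y ^+ 2.
  by rewrite expr2 mulrCA ler_wpM2l// ltW.
have hM0 : 0 <= M by rewrite (le_trans _ M1).
have hA : x ^+ 2 * p * i30 <= K ^+ 3 * M * x ^+ 3.
  apply: (@le_trans _ _ (K ^+ 3 * x ^+ 3 * M)); last by rewrite mulrAC.
  rewrite ler_pM ?mulr_ge0 ?sqr_ge0//.
  apply: (@le_trans _ _ (x * (K * x ^+ 2))).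
    by rewrite expr2 -mulrA ler_wpM2l// ltW.
  by rewrite mulrCA -exprS ler_wpM2r ?exprn_ge0 ?(ltW x0)// (le_trans KK).
have hB : y ^+ 2 * q * i03 <= K ^+ 3 * M * y ^+ 3.
  apply: (@le_trans _ _ (K ^+ 3 * y ^+ 3 * M)); last by rewrite mulrAC.
  rewrite ler_pM ?mulr_ge0 ?sqr_ge0//.
  apply: (@le_trans _ _ (y * (K * y ^+ 2))).
    by rewrite expr2 -mulrA ler_wpM2l// ltW.
  by rewrite mulrCA -exprS ler_wpM2r ?exprn_ge0 ?(ltW y0)// (le_trans KK).
have hpq : p * q <= K ^+ 2 * (x * y).
  by rewrite (_ : _ * (x * y) = K * x * (K * y)); [rewrite ler_pM|ring].
have hE : p * q * i11 <= K ^+ 2 * M * (x * y).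
  apply: (@le_trans _ _ (K ^+ 2 * (x * y) * M)); last by rewrite mulrAC.
  by rewrite ler_pM ?mulr_ge0//.
have hD1 : x * p * q * i21 <= K ^+ 3 * M * (x ^+ 2 * y).
  apply: (@le_trans _ _ (K ^+ 3 * (x ^+ 2 * y) * M)); last by rewrite mulrAC.
  rewrite ler_pM ?mulr_ge0 ?(ltW x0)//.
  apply: (@le_trans _ _ (x * (K ^+ 2 * (x * y)))).
    by rewrite -mulrA ler_wpM2l// ltW.
  rewrite [leLHS](_ : _ = K ^+ 2 * (x ^+ 2 * y)); last by ring.
  by rewrite ler_wpM2r// mulr_ge0 ?sqr_ge0// ltW.
have hD2 : x * y * q * i12 <= K ^+ 3 * M * (x * y ^+ 2).
  apply: (@le_trans _ _ (K ^+ 3 * (x * y ^+ 2) * M)); last by rewrite mulrAC.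
  rewrite ler_pM ?mulr_ge0 ?(ltW x0) ?(ltW y0)//.
  apply: (@le_trans _ _ (x * (K * y ^+ 2))).
    by rewrite -mulrA ler_wpM2l// ltW.
  rewrite mulrCA ler_wpM2r//; last exact: le_trans KK KKK.
  by rewrite mulr_ge0 ?sqr_ge0// ltW.
(* Here |Im| >= 2 does its work: |a| and |b| are at most 1/4, which keeps 1 + a and 1 + b away from
   0. *)
have xp4 : x * p <= 2^-1.
  by apply: (@le_trans _ _ (2^-1 * 2^-1)); [rewrite ler_pM// ltW|lra].
have yq4 : y * q <= 2^-1.
  by apply: (@le_trans _ _ (2^-1 * 2^-1)); [rewrite ler_pM// ltW|lra].
have x01 : 0 <= x <= 1 by lra.
have y01 : 0 <= y <= 1 by lra.
apply: le_trans (normc_self_energy_remainder_le x01 y01 K1 M1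
  (le_trans na xp4) (le_trans nb yq4) (le_trans na hxp) (le_trans nb hyq)
  (le_trans ne hE) (le_trans ra hA) (le_trans rb hB)
  (le_trans re (lerD hD1 hD2))) _.
have X0 : 0 <= K ^+ 3 * M * x ^+ 3 by rewrite !mulr_ge0 ?exprn_ge0.
have Y0 : 0 <= K ^+ 3 * M * y ^+ 3 by rewrite !mulr_ge0 ?exprn_ge0.
have Z0 : 0 <= K ^+ 3 * M * (x * y ^+ 2) by rewrite !mulr_ge0 ?exprn_ge0.
have W0 : 0 <= K ^+ 3 * M * (x ^+ 2 * y) by rewrite !mulr_ge0 ?exprn_ge0.
lra.
Qed.

Lemma inv_Im_bounds (K : R)
  (v : R[i]) : 1 <= K -> 2 <= `|Im v| -> normc v <= K * `|Im v| ->
  [/\ 0 < (normc v)^-1 <= 2^-1, 0 <= `|Im v|^-1 <= 2^-1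
    & `|Im v|^-1 <= K * (normc v)^-1].
Proof.
move=> K1 v2 vK; have v0 := normr_Im_le v.
have n0 : 0 < normc v by lra.
have i0 : 0 < `|Im v| by lra.
split.
- by rewrite invr_gt0 n0 lef_pV2 ?posrE//; lra.
- by rewrite invr_ge0 normr_ge0 lef_pV2 ?posrE.
- by rewrite ler_pdivlMr// mulrC ler_pdivrMr.
Qed.

Lemma partial_self_energy_expansion (c : R) mu (K : R) :
  standardized_third_moments c mu -> 1 <= K ->
  exists2 C : R, 0 < C & forall z w,
    2 <= `|Im z| -> normc z <= K * `|Im z| ->
    2 <= `|Im w| -> normc w <= K * `|Im w| ->
    normc (partial_self_energy mu z w - (z ^+ 2)^-1 - (w ^+ 2)^-1 - c%:C /
      (z * w))
    <= C * \sum_(k < 4) ((normc z)^-1 ^+ k * (normc w)^-1 ^+ (3 - k)%N).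
Proof.
move=> [h [E1 E2] [V1 V2] cov] K1.
have m1 : measurable_fun setT (fun p : R * R => p.1) by exact: measurable_fst.
have m2 : measurable_fun setT (fun p : R * R => p.2) by exact: measurable_snd.
rewrite moment_marginal1// in E1; rewrite moment_marginal1// in V1.
rewrite moment_marginal2// in E2; rewrite moment_marginal2// in V2.
pose I k l := \int[mu]_p (`|p.1| ^+ k * `|p.2| ^+ l).
have I0 k l : 0 <= I k l.
  by apply: Rintegral_ge0 => p _; rewrite mulr_ge0 ?exprn_ge0.
(* A common bound for all absolute moments in the error terms; the summand 1 secures [1 <= M], by
   which x and y are absorbed into M. *)
pose M := 1 + I 3 0 + I 0 3 + I 2 1 + I 1 2 + I 1 1.
have i30 := I0 3%N 0%N; have i03 := I0 0%N 3%N.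
have i21 := I0 2%N 1%N; have i12 := I0 1%N 2%N; have i11 := I0 1%N 1%N.
have M1 : 1 <= M by rewrite /M; lra.
have M30 : 0 <= I 3%N 0%N <= M by rewrite /M; lra.
have M03 : 0 <= I 0%N 3%N <= M by rewrite /M; lra.
have M21 : 0 <= I 2%N 1%N <= M by rewrite /M; lra.
have M12 : 0 <= I 1%N 2%N <= M by rewrite /M; lra.
have M11 : 0 <= I 1%N 1%N <= M by rewrite /M; lra.
clear i30 i03 i21 i12 i11.
have K0 : 0 <= K by lra.
have C0 : 0 < K ^+ 3 * M by rewrite mulr_gt0 ?exprn_gt0//; lra.
have iX : mu.-integrable setT (EFin \o (fun p : R * R => p.1)).
  apply: eq_integrable (@integrable_moment _ 1 0 h isT) => // p _ /=.
  by rewrite mulr1.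
have iY : mu.-integrable setT (EFin \o (fun p : R * R => p.2)).
  apply: eq_integrable (@integrable_moment _ 0 1 h isT) => // p _ /=.
  by rewrite mul1r.
have iX2 : mu.-integrable setT (EFin \o (fun p : R * R => p.1 ^+ 2)).
  apply: eq_integrable (@integrable_moment _ 2 0 h isT) => // p _ /=.
  by rewrite mulr1.
have iY2 : mu.-integrable setT (EFin \o (fun p : R * R => p.2 ^+ 2)).
  apply: eq_integrable (@integrable_moment _ 0 2 h isT) => // p _ /=.
  by rewrite mul1r.
have iX3 : mu.-integrable setT (EFin \o (fun p : R * R => `|p.1| ^+ 3)).
  apply: eq_integrable (@integrable_abs_moment _ 3 0 h isT) => // p _ /=.
  by rewrite mulr1.
have iY3 : mu.-integrable setT (EFin \o (fun p : R * R => `|p.2| ^+ 3)).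
  apply: eq_integrable (@integrable_abs_moment _ 0 3 h isT) => // p _ /=.
  by rewrite mul1r.
have iXY := @integrable_moment _ 1 1 h isT.
have iX2Y := @integrable_abs_moment _ 2 1 h isT.
have iXY2 := @integrable_abs_moment _ 1 2 h isT.
have I30 : \int[mu]_p `|p.1| ^+ 3 = I 3%N 0%N.
  by apply: eq_Rintegral => p _; rewrite mulr1.
have I03 : \int[mu]_p `|p.2| ^+ 3 = I 0%N 3%N.
  by apply: eq_Rintegral => p _; rewrite mul1r.
have I11 : \int[mu]_p `|p.1 * p.2| = I 1%N 1%N.
  by apply: eq_Rintegral => p _; rewrite normrM.
exists (16 * (K ^+ 3 * M)); first by rewrite mulr_gt0.
move=> z w z2 zK w2 wK.
have nz : nonreal z by rewrite /nonreal -normr_gt0 (lt_le_trans _ z2).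
have nw : nonreal w by rewrite /nonreal -normr_gt0 (lt_le_trans _ w2).
have [x2 p2 pK] := inv_Im_bounds K1 z2 zK;
  have [y2 q2 qK] := inv_Im_bounds K1 w2 wK.
rewrite partial_self_energyE// !cauchy_marginal1// !cauchy_marginal2// cauchy2E.
have na := normc_resolvent_first_order m1 nz iX iX2 E1 V1.
have nb := normc_resolvent_first_order m2 nw iY iY2 E2 V2.
have ra := normc_resolvent_second_order m1 nz iX iX2 iX3 E1 V1.
have rb := normc_resolvent_second_order m2 nw iY iY2 iY3 E2 V2.
have ne := normc_resolvent_covariance m1 m2 nz nw iXY.
have re := normc_resolvent_covariance_second_order m1 m2 nz nw iXY iX2Y iXY2.
rewrite I30 I03 I11 in na nb ra rb ne re.
rewrite (_ : \int[mu]_p (p.1 * p.2) = c) in re; last exact: cov.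
apply: le_trans (normc_self_energy_remainder_le16 x2 y2 p2 q2 pK qK K1 M1
  M30 M03 M21 M12 M11 na nb ne ra rb re) _.
rewrite ler_wpM2l//; first by rewrite mulr_ge0// ltW.
rewrite !big_ord_recr big_ord0/= !expr0 !expr1 mulr1 mul1r add0r.
by rewrite le_eqVlt; apply/orP; left; apply/eqP; ring.
Qed.

End Expansion.

(** * Rate of convergence in the bi-Boolean distance *)

Section Rate.
Context {R : realType}.
Local Notation Re := (@complex.Re _).
Local Notation Im := (@complex.Im _).
Local Notation normc := Normc.normc.
Implicit Types (mu nu gamma : planar_probability R) (z w : R[i]).

Lemma partial_self_energy_power n mu nu z w :
  bi_boolean_power n mu nu -> nonreal z -> nonreal w ->
  partial_self_energy nu z w = n%:R * partial_self_energy mu z w.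
Proof.
by move=> h nz nw; rewrite (h z w nz nw) big_nseq iter_addr_0 mulr_natl.
Qed.

(** The lower bound is put on sqrt n |Im| rather than on |Im|, since the expansion is evaluated at
    the rescaled points. Any fixed nonreal pair therefore qualifies for large n. A real scaling
    leaves the aperture K unchanged. *)
Lemma partial_self_energy_rate (c : R) mu (K : R) :
  standardized_third_moments c mu -> 1 <= K ->
  exists2 C : R, 0 < C & forall n nu z w,
    (0 < n)%N -> bi_boolean_power n mu nu ->
    nonreal z -> 2 <= Num.sqrt n%:R * `|Im z| -> normc z <= K * `|Im z| ->
    nonreal w -> 2 <= Num.sqrt n%:R * `|Im w| -> normc w <= K * `|Im w| ->
    normc (partial_self_energy (dilation (Num.sqrt n%:R)^-1 nu) z w
           - (z ^+ 2)^-1 - (w ^+ 2)^-1 - c%:C / (z * w))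
    <= C / Num.sqrt n%:R
       * \sum_(k < 4) ((normc z)^-1 ^+ k * (normc w)^-1 ^+ (3 - k)%N).
Proof.
move=> hmu K1; have [C C0 hC] := partial_self_energy_expansion hmu K1.
exists C => // n nu z w n0 hn nz z2 zK nw w2 wK.
set s := Num.sqrt n%:R.
have s0 : 0 < s by rewrite sqrtr_gt0 ltr0n.
have sn : s ^+ 2 = n%:R by rewrite sqr_sqrtr// ler0n.
have sC : s%:C ^+ 2 = n%:R by rewrite -rmorphXn/= sn rmorph_nat.
have sC0 : s%:C != 0 :> R[i] by rewrite (inj_eq (@complexI R)) gt_eqF.
have ImS v : `|Im (s%:C * v)| = s * `|Im v|.
  by rewrite cImM/= mul0r addr0 normrM gtr0_norm.
have nS v : normc (s%:C * v) = s * normc v.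
  by rewrite Normc.normcM normc_real gtr0_norm.
have nsz := nonreal_scale (lt0r_neq0 s0) nz.
have nsw := nonreal_scale (lt0r_neq0 s0) nw.
rewrite partial_self_energy_dilation ?invr_eq0 ?gt_eqF// invrK.
rewrite (partial_self_energy_power hn)// -sC.
have z0 := nonreal_neq0 nz; have w0 := nonreal_neq0 nw.
(* The Gaussian self-energy is homogeneous of degree -2, so the factor n = s^2 reproduces it exactly
   and multiplies only the remainder. *)
have -> : s%:C ^+ 2 * partial_self_energy mu (s%:C * z) (s%:C * w)
    - (z ^+ 2)^-1 - (w ^+ 2)^-1 - c%:C / (z * w)
  = s%:C ^+ 2 * (partial_self_energy mu (s%:C * z) (s%:C * w)
    - ((s%:C * z) ^+ 2)^-1 - ((s%:C * w) ^+ 2)^-1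
    - c%:C / ((s%:C * z) * (s%:C * w))).
  move: (partial_self_energy _ _ _) (c%:C) => E c'.
  move: (s%:C) sC0 => t t0; field.
  by rewrite t0 z0 w0.
rewrite Normc.normcM normcX normc_real gtr0_norm//.
apply: le_trans (ler_wpM2l (sqr_ge0 s) (hC (s%:C * z) (s%:C * w) _ _ _ _)) _.
- by rewrite ImS.
- by rewrite ImS nS mulrCA ler_wpM2l// ltW.
- by rewrite ImS.
- by rewrite ImS nS mulrCA ler_wpM2l// ltW.
rewrite !big_ord_recr !big_ord0/= !nS !expr0 !expr1.
move: (normc z) (normc w) => x y.
rewrite !invfM le_eqVlt; apply/orP; left; apply/eqP.
move: (x^-1) (y^-1) => x' y'; field.
exact: lt0r_neq0.
Qed.

(** The disc |z + i/4| < 1/4 is 2 |z|^2 < - Im z, which inversion carries to Im > 2. Inversion also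
    preserves the ratio |z| / |Im z|, which on the Stolz angle is at most 1 + alpha because |z| <=
    |Re z| + |Im z|. *)
Lemma stolz_sym_bounds (alpha beta : R) z : 0 < alpha ->
  stolz alpha beta `<=` stolz_disc -> stolz_sym alpha beta z ->
  [/\ nonreal z, 2 <= `|Im z^-1| & normc z^-1 <= (1 + alpha) * `|Im z^-1|].
Proof.
move=> a0 sub.
have key v : Im v != 0 -> `|Re v| < alpha * `|Im v| ->
    2 * (Re v ^+ 2 + Im v ^+ 2) <= `|Im v| ->
    [/\ nonreal v, 2 <= `|Im v^-1| & normc v^-1 <= (1 + alpha) * `|Im v^-1|].
  move=> v0 va vd; have nv : 0 < normc v by rewrite normc_gt0 nonreal_neq0.
  have N0 : 0 < normc v ^+ 2 by rewrite exprn_gt0.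
  have ImvE : `|Im v^-1| = `|Im v| / normc v ^+ 2.
    by rewrite cImV normrN normrM -normc_sqrE normfV (ger0_norm (ltW N0)).
  split => //; rewrite ImvE.
    by rewrite ler_pdivlMr// normc_sqrE.
  rewrite Normc.normcV mulrA ler_pdivlMr// expr2 mulKf ?gt_eqF//.
  by rewrite (le_trans (normc_le_ReIm _))// mulrDl mul1r addrC lerD2l ltW.
have base v : stolz alpha beta v ->
    [/\ Im v != 0, `|Re v| < alpha * `|Im v|
      & 2 * (Re v ^+ 2 + Im v ^+ 2) <= `|Im v|].
  move=> sv; have := sub _ sv; move: sv => [v0 va _].
  rewrite /stolz_disc/= => hd.
  have : normc (v + 0 +i* 4^-1) ^+ 2 < 4^-1 ^+ 2.
    by rewrite ltr_pXn2r// nnegrE// normc_ge0.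
  rewrite normc_sqrE cReD cImD/= addr0 => hd'.
  rewrite (ltr0_norm v0) lt_eqF//; split => //; first by rewrite mulrN -mulNr.
  by nra.
case=> [/base[? ? ?]|[v /base[v0 va vd] <-]]; first exact: key.
by apply: key; case: v v0 va vd => x y /=; rewrite ?oppr_eq0 ?normrN ?sqrrN.
Qed.

(** Inverses of points of the Stolz angle have |Im| >= 2 already, and sqrt n >= 1, so the rate
    applies for every n >= 1 with the aperture 1 + alpha. *)
Lemma dBB_power_le (alpha beta c : R) mu gamma :
  0 < alpha -> stolz alpha beta `<=` stolz_disc ->
  standardized_third_moments c mu -> bi_boolean_gaussian c gamma ->
  exists2 C : R, 0 < C & forall n nu, (1 <= n)%N -> bi_boolean_power n mu nu ->
    (dBB alpha beta (dilation (Num.sqrt n%:R)^-1 nu) gamma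
     <= (C / Num.sqrt n%:R)%:E)%E.
Proof.
move=> a0 sub hmu hg.
have K1 : 1 <= 1 + alpha by rewrite lerDl ltW.
have [C C0 hC] := partial_self_energy_rate hmu K1.
exists C => // n nu n0 hn; apply: ge_ereal_sup => _ [[z w]] /= [zD wD] <-.
have [nz z2 zK] := stolz_sym_bounds a0 sub zD.
have [nw w2 wK] := stolz_sym_bounds a0 sub wD.
have s1 : 1 <= Num.sqrt n%:R :> R.
  by rewrite -[leLHS](@sqrtr1 R) ler_wsqrtr// ler1n.
have z0 : 0 < normc z by rewrite normc_gt0 nonreal_neq0.
have w0 : 0 < normc w by rewrite normc_gt0 nonreal_neq0.
have up (v : R[i]) : 2 <= `|Im v| -> 2 <= Num.sqrt n%:R * `|Im v|.
  by move=> h; apply: (le_trans h); rewrite ler_peMl.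
have := hC n nu _ _ n0 hn (nonrealV nz) (up _ z2) zK (nonrealV nw) (up _ w2) wK.
rewrite lee_fin ler_pdivrMr; last first.
  rewrite !big_ord_recr !big_ord0/= add0r.
  by rewrite !addr_gt0 ?mulr_gt0 ?exprn_gt0.
move=> h; apply: le_trans (le_trans _ h) _; last first.
  by rewrite !Normc.normcV !invrK.
by rewrite (hg _ _ (nonrealV nz) (nonrealV nw)) !opprD !addrA.
Qed.

End Rate.

(** * Limits of complex sequences *)

Section ComplexConvergence.
Context {R : realType}.
Local Notation Re := (@complex.Re _).
Local Notation Im := (@complex.Im _).
Local Notation normc := Normc.normc.
Implicit Types (u v : nat -> R[i]) (l k : R[i]).

Definition Ccvg u l := (Re \o u @ \oo --> Re l) /\ (Im \o u @ \oo --> Im l).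

Lemma Ccvg_cst l : Ccvg (fun=> l) l.
Proof. by split; exact: cvg_cst. Qed.

Lemma CcvgD u v l k : Ccvg u l -> Ccvg v k -> Ccvg (fun n => u n + v n) (l + k).
Proof.
move=> [u1 u2] [v1 v2]; split.
- by rewrite cReD (_ : _ \o _ = fun n => Re (u n) + Re (v n));
    [exact: cvgD|apply/funext => n /=; rewrite cReD].
- by rewrite cImD (_ : _ \o _ = fun n => Im (u n) + Im (v n));
    [exact: cvgD|apply/funext => n /=; rewrite cImD].
Qed.

Lemma CcvgM u v l k : Ccvg u l -> Ccvg v k -> Ccvg (fun n => u n * v n) (l * k).
Proof.
move=> [u1 u2] [v1 v2]; split.
- rewrite cReM (_ : _ \o _ = fun n =>
  Re (u n) * Re (v n) - Im (u n) * Im (v n)).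
    by apply: cvgB; exact: cvgM.
  by apply/funext => n /=; rewrite cReM.
- rewrite cImM (_ : _ \o _ = fun n =>
  Re (u n) * Im (v n) + Im (u n) * Re (v n)).
    by apply: cvgD; exact: cvgM.
  by apply/funext => n /=; rewrite cImM.
Qed.

Lemma CcvgN u l : Ccvg u l -> Ccvg (fun n => - u n) (- l).
Proof.
move=> ul; rewrite -mulN1r (_ : (fun n => _) = fun n => -1 * u n).
  exact: CcvgM (Ccvg_cst _) ul.
by apply/funext => n; rewrite mulN1r.
Qed.

Lemma CcvgB u v l k : Ccvg u l -> Ccvg v k -> Ccvg (fun n => u n - v n) (l - k).
Proof. by move=> ul vk; apply: CcvgD => //; exact: CcvgN. Qed.

Lemma CcvgV u l : l != 0 -> Ccvg u l -> Ccvg (fun n => (u n)^-1) l^-1.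
Proof.
move=> l0 [u1 u2].
have n0 : Re l ^+ 2 + Im l ^+ 2 != 0.
  by rewrite -normc_sqrE expf_neq0// gt_eqF// normc_gt0.
have cn : (fun n => (Re (u n) ^+ 2 + Im (u n) ^+ 2)^-1) @ \oo
    --> (Re l ^+ 2 + Im l ^+ 2)^-1.
  by apply: cvgV => //; apply: cvgD; rewrite expr2;
    under eq_fun do rewrite expr2; exact: cvgM.
split.
- rewrite cReV (_ : _ \o _ = fun n =>
  Re (u n) * (Re (u n) ^+ 2 + Im (u n) ^+ 2)^-1).
    exact: cvgM.
  by apply/funext => n /=; rewrite cReV.
- rewrite cImV (_ : _ \o _ = fun n =>
  - (Im (u n) * (Re (u n) ^+ 2 + Im (u n) ^+ 2)^-1)).
    by apply: cvgN; exact: cvgM.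
  by apply/funext => n /=; rewrite cImV.
Qed.

Lemma Ccvg_squeeze u l (v : nat -> R) :
  (\forall n \near \oo, normc (u n - l) <= v n) -> v @ \oo --> 0 -> Ccvg u l.
Proof.
move=> h v0.
have sq (f : R[i] -> R) : (forall z w, f (z - w) = f z - f w) ->
    (forall z, `|f z| <= normc z) -> f \o u @ \oo --> f l.
  move=> fB fn; apply/cvgrPdist_le => e e0.
  move/cvgrPdist_le : v0 => /(_ e e0) v0.
  near=> n; rewrite -normrN opprB -fB (le_trans (fn _))//.
  rewrite (@le_trans _ _ (v n))//; first by near: n.
  rewrite (le_trans (ler_norm _))// -normrN -sub0r.
  by near: n.
by split; apply: sq => *; rewrite ?cReD ?cReN ?cImD ?cImN ?normr_Re_le
  ?normr_Im_le.
Unshelve. all: by end_near. Qed.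

(** The real and imaginary parts are bounded by B separately, whence the factor 2, harmless for a
    bound that tends to 0. *)
Lemma Ccvg_normc_le u l k (B : R) : Ccvg u l ->
  (forall n, normc (u n - k) <= B) -> normc (l - k) <= B + B.
Proof.
move=> [u1 u2] h; apply: le_trans (normc_le_ReIm _) _; apply: lerD.
- rewrite cReD cReN; apply: (@cvgr_to_le nat \oo _ R (fun n =>
  `|Re (u n) - Re k|)).
    by apply: cvg_norm; apply: cvgB => //; exact: cvg_cst.
  by near=> n; rewrite -cReN -cReD (le_trans (normr_Re_le _)).
- rewrite cImD cImN; apply: (@cvgr_to_le nat \oo _ R (fun n =>
  `|Im (u n) - Im k|)).
    by apply: cvg_norm; apply: cvgB => //; exact: cvg_cst.
  by near=> n; rewrite -cImN -cImD (le_trans (normr_Im_le _)).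
Unshelve. all: by end_near. Qed.

Lemma Ccvg_unique u l k : Ccvg u l -> Ccvg u k -> l = k.
Proof.
move=> [u1 u2] [k1 k2]; apply/eqP; rewrite eq_complex.
by rewrite (cvg_unique _ u1 k1)// (cvg_unique _ u2 k2)// !eqxx.
Qed.

Lemma Rintegral_dominated_cvg d (T : measurableType d)
    (mu : {measure set T -> \bar R}) (f_ : nat -> T -> R) (f g : T -> R) :
  (forall n, measurable_fun setT (f_ n)) -> measurable_fun setT f ->
  (forall x, f_ ^~ x @ \oo --> f x) -> mu.-integrable setT (EFin \o g) ->
  (forall n x, `|f_ n x| <= g x) ->
  (fun n => \int[mu]_x f_ n x) @ \oo --> \int[mu]_x f x.
Proof.
move=> mf_ mf ff ig fg.
have mE h : measurable_fun setT h -> measurable_fun setT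
  (EFin \o h : T -> \bar R).
  by move=> mh; exact/measurable_EFinP.
have ffE x : EFin (f_ n x) @[n --> \oo] --> EFin (f x).
  by apply: cvg_EFin (ff x); exact: nearW.
have [fi _ h] := @dominated_convergence _ _ _ mu _ measurableT
  (fun n => EFin \o f_ n) (EFin \o f) (EFin \o g)
  (fun n => mE _ (mf_ n)) (mE _ mf)
  (aeW _ (fun x _ => ffE x)) ig
  (aeW _ (fun x n _ => fg n x)).
rewrite /Rintegral; apply: fine_cvg; rewrite fineK//.
exact: integrable_fin_num.
Qed.

Lemma Cintegral_dominated_cvg d (T : measurableType d)
    (mu : {measure set T -> \bar R}) (f_ : nat -> T -> R[i]) (f : T -> R[i])
    (g : T -> R) :
  (forall n, Cmeasurable (f_ n)) -> Cmeasurable f ->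
  (forall x, Ccvg (f_ ^~ x) (f x)) -> mu.-integrable setT (EFin \o g) ->
  (forall n x, normc (f_ n x) <= g x) ->
  Ccvg (fun n => Cintegral mu (f_ n)) (Cintegral mu f).
Proof.
move=> mf_ mf ff ig fg; split.
- apply: (@Rintegral_dominated_cvg _ _ _ _ _ g) => //.
  + by move=> n; have [] := mf_ n.
  + by have [] := mf.
  + by move=> x; have [] := ff x.
  + by move=> n x; rewrite (le_trans (normr_Re_le _)).
- apply: (@Rintegral_dominated_cvg _ _ _ _ _ g) => //.
  + by move=> n; have [] := mf_ n.
  + by have [] := mf.
  + by move=> x; have [] := ff x.
  + by move=> n x; rewrite (le_trans (normr_Im_le _)).
Qed.

End ComplexConvergence.

(** * Marginal self-energies as limits along the imaginary axis *)

Section Marginals.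
Context {d} {T : measurableType d} {R : realType} (P : probability T R).
Local Notation Re := (@complex.Re _).
Local Notation Im := (@complex.Im _).
Local Notation normc := Normc.normc.

(** The shift by one keeps every [iy m] nonreal and of modulus at least 1. *)
Let iy (m : nat) : R[i] := 0 +i* m.+1%:R.

Let iy_neq0 m : iy m != 0.
Proof. by rewrite nonreal_neq0// /nonreal /= pnatr_eq0. Qed.

Let nonreal_iy m : nonreal (iy m).
Proof. by rewrite /nonreal /= pnatr_eq0. Qed.

Let normc_iy m : normc (iy m) = m.+1%:R.
Proof. by rewrite normc_sqrtE/= expr0n/= add0r sqrtr_sqr ger0_norm. Qed.

Lemma cvg_inv_iy : Ccvg (fun m => (iy m)^-1) 0.
Proof.
apply: (@Ccvg_squeeze _ _ _ (fun m => m.+1%:R^-1)); last exact: cvg_harmonic.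
by near=> m; rewrite subr0 Normc.normcV normc_iy.
Unshelve. all: by end_near. Qed.

Let cvg_resolvent_iy (t : R) : Ccvg (fun m => iy m * (iy m - t%:C)^-1) 1.
Proof.
apply: (@Ccvg_squeeze _ _ _ (fun m => `|t| * m.+1%:R^-1)).
  near=> m; have n0 : iy m - t%:C != 0 by exact/nonreal_neq0/nonreal_sub.
  rewrite (_ : _ - 1 = t%:C * (iy m - t%:C)^-1); last by field.
  rewrite Normc.normcM normc_real ler_wpM2l//
    (le_trans (normc_resolvent_le _ _))//.
  by rewrite /= ger0_norm.
rewrite -(mulr0 `|t|); apply: cvgM; first exact: cvg_cst.
exact: cvg_harmonic.
Unshelve. all: by end_near. Qed.

Let normc_resolvent_iy (t : R) m : normc (iy m * (iy m - t%:C)^-1) <= 1.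
Proof.
rewrite Normc.normcM normc_iy (le_trans (ler_wpM2l _
  (normc_resolvent_le _ _)))//.
by rewrite /= ger0_norm// mulfV// pnatr_eq0.
Qed.

(** As |iy/(iy - t)| <= 1 and this quotient tends to 1, dominated convergence gives iy GY(iy) -> 1
    and iy G(iy) -> GX. So the Y term tends to 0 and the quotient of transforms to 1. With arbitrary
    X and Y, exchanging the coordinates yields the other marginal. *)
Lemma cvg_partial_energy_iy (X Y : T -> R) (z : R[i]) :
  measurable_fun setT X -> measurable_fun setT Y -> nonreal z ->
  let GX := Cintegral P (fun x => (z - (X x)%:C)^-1) in
  let GY w := Cintegral P (fun x => (w - (Y x)%:C)^-1) in
  let G w := Cintegral P (fun x => (z - (X x)%:C)^-1 * (w - (Y x)%:C)^-1) in
  Ccvg (fun m => z^-1 * (z - GX^-1) + (iy m)^-1 * (iy m - (GY (iy m))^-1)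
                 + G (iy m) / (GX * GY (iy m)) - 1)
    (z^-1 * (z - GX^-1)).
Proof.
move=> mX mY nz GX GY G.
have GX0 : GX != 0 by exact: Cintegral_resolvent_neq0.
have GY0 m : GY (iy m) != 0 by exact: Cintegral_resolvent_neq0.
have cGY : Ccvg (fun m => iy m * GY (iy m)) 1.
  rewrite -(Cintegral_cst P 1).
  rewrite (_ : (fun m => _) =
    fun m => Cintegral P (fun x => iy m * (iy m - (Y x)%:C)^-1)); last first.
    by apply/funext => m; rewrite CintegralZl//; exact: Cintegrable_resolvent.
  apply: (@Cintegral_dominated_cvg _ _ _ _ _ _ (cst 1)) => //.
  - move=> m; apply: CmeasurableM; first exact: Cmeasurable_cst.
    exact: Cmeasurable_resolvent.
  - exact: Cmeasurable_cst.
  - exact: finite_measure_integrable_cst.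
have cG : Ccvg (fun m => iy m * G (iy m)) GX.
  rewrite (_ : (fun m => _) = fun m => Cintegral P
     (fun x => (z - (X x)%:C)^-1 * (iy m * (iy m - (Y x)%:C)^-1))); last first.
    apply/funext => m; rewrite -CintegralZl; last exact: Cintegrable_resolventM.
    by apply: eq_Cintegral => x; rewrite mulrCA.
  apply: (@Cintegral_dominated_cvg _ _ _ _ _ _ (cst (`|Im z|^-1 * 1))) => //.
  - move=> m; apply: CmeasurableM; first exact: Cmeasurable_resolvent.
    apply: CmeasurableM; first exact: Cmeasurable_cst.
    exact: Cmeasurable_resolvent.
  - exact: Cmeasurable_resolvent.
  - move=> x; rewrite -[X in Ccvg _ X]mulr1.
    by apply: CcvgM; [exact: Ccvg_cst|exact: cvg_resolvent_iy].
  - exact: finite_measure_integrable_cst.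
  - move=> m x; rewrite Normc.normcM ler_pM ?normc_ge0//.
    exact: normc_resolvent_le.
pose v m := (iy m * GY (iy m))^-1.
have cv : Ccvg v 1 by rewrite -invr1; apply: CcvgV => //; exact: oner_neq0.
(* [G (iy m)] and [GY (iy m)] both tend to 0; each is multiplied by [iy m] so that their quotient
   becomes one of convergent sequences with nonzero denominator. *)
have -> : (fun m => z^-1 * (z - GX^-1) + (iy m)^-1 * (iy m - (GY (iy m))^-1)
      + G (iy m) / (GX * GY (iy m)) - 1)
    = (fun m => z^-1 * (z - GX^-1) + (1 - v m) + (GX^-1 * (iy m * G
      (iy m))) * v m - 1).
  apply/funext => m; rewrite /v.
  have := GY0 m; have := iy_neq0 m; move: (GY (iy m)) (G (iy m)) => g1 g;
    move: (iy m) => w w0 g0.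
  have z0 := nonreal_neq0 nz.
  by field; rewrite GX0 w0 g0 z0.
rewrite -[X in Ccvg _ X](_ : z^-1 * (z - GX^-1) + (1 - 1) +
  (GX^-1 * GX) * 1 - 1 = _).
  apply: CcvgB; last exact: Ccvg_cst.
  apply: CcvgD; last by apply: CcvgM => //; apply: CcvgM => //; exact: Ccvg_cst.
  by apply: CcvgD; [exact: Ccvg_cst|apply: CcvgB => //; exact: Ccvg_cst].
by rewrite mulVf//; ring.
Qed.

End Marginals.

(** * Convergence of the self-energies to the Gaussian ones *)

Section GaussianLimit.
Context {R : realType} (c : R).
Local Notation Re := (@complex.Re _).
Local Notation Im := (@complex.Im _).
Local Notation normc := Normc.normc.
Implicit Types (mu nu gamma : planar_probability R) (z w : R[i]).

Let iy (m : nat) : R[i] := 0 +i* m.+1%:R.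

Let nonreal_iy m : nonreal (iy m).
Proof. by rewrite /nonreal /= pnatr_eq0. Qed.

Let normc_iy m : normc (iy m) = m.+1%:R.
Proof. by rewrite normc_sqrtE/= expr0n/= add0r sqrtr_sqr ger0_norm. Qed.

Let Im_iy m : `|Im (iy m)| = m.+1%:R.
Proof. by rewrite /= ger0_norm. Qed.

Lemma cvg_partial_self_energy_marginal1 mu z : nonreal z ->
  Ccvg (fun m => partial_self_energy mu z (iy m))
    (z^-1 * self_energy (marginal1 mu) z).
Proof.
move=> nz; have := @cvg_partial_energy_iy _ _ _ mu
  _ _ z measurable_fst measurable_snd nz.
rewrite /self_energy cauchy_marginal1//; congr (Ccvg _ _).
apply/funext => m; rewrite /partial_self_energy /self_energy.
by rewrite cauchy_marginal1// cauchy_marginal2// cauchy2E.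
Qed.

Lemma cvg_partial_self_energy_marginal2 mu w : nonreal w ->
  Ccvg (fun m => partial_self_energy mu (iy m) w)
    (w^-1 * self_energy (marginal2 mu) w).
Proof.
move=> nw; have := @cvg_partial_energy_iy _ _ _ mu
  _ _ w measurable_snd measurable_fst nw.
rewrite /self_energy cauchy_marginal2//; congr (Ccvg _ _).
apply/funext => m; rewrite /partial_self_energy /self_energy.
rewrite cauchy_marginal1// cauchy_marginal2// cauchy2E.
rewrite [in RHS](mulrC (Cintegral mu (fun p => (iy m - p.1%:C)^-1))).
rewrite [in RHS](addrC ((iy m)^-1 * _)); congr (_ + _ / _ - 1).
by apply: eq_Cintegral => p; rewrite mulrC.
Qed.

Let target z w : R[i] := (z ^+ 2)^-1 + (w ^+ 2)^-1 + c%:C / (z * w).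

Definition gaussian_rate (rho : nat -> planar_probability R) :=
  forall K : R, 1 <= K -> exists2 C : R, 0 < C & forall n z w, (0 < n)%N ->
    nonreal z -> 2 <= Num.sqrt n%:R * `|Im z| -> normc z <= K * `|Im z| ->
    nonreal w -> 2 <= Num.sqrt n%:R * `|Im w| -> normc w <= K * `|Im w| ->
    normc (partial_self_energy (rho n) z w - target z w)
    <= C / Num.sqrt n%:R
       * \sum_(k < 4) ((normc z)^-1 ^+ k * (normc w)^-1 ^+ (3 - k)%N).

Lemma gaussian_rate_cst gamma :
  bi_boolean_gaussian c gamma -> gaussian_rate (fun=> gamma).
Proof.
move=> hg K K1; exists 1 => // n z w n0 nz _ _ nw _ _.
rewrite hg// /target subrr Normc.normc0 mulr_ge0//.
by apply: sumr_ge0 => k _; rewrite mulr_ge0// exprn_ge0// invr_ge0 normc_ge0.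
Qed.

Let cone z : nonreal z -> exists2 K, 1 <= K & normc z <= K * `|Im z|.
Proof.
move=> nz; exists (1 + normc z / `|Im z|).
  by rewrite lerDl divr_ge0// normc_ge0.
by rewrite mulrDl divfK ?normr_eq0// lerDr mul1r.
Qed.

Let near_sqrt (a : R) : 0 < a -> \forall n \near \oo,
  2 <= Num.sqrt (n%:R : R) * a.
Proof.
move=> a0; near=> n.
have a2 : 0 <= 2 / a by rewrite divr_ge0// ltW.
rewrite -ler_pdivrMr// -(ger0_norm a2) -sqrtr_sqr ler_wsqrtr//.
by near: n; exact: nbhs_infty_ger.
Unshelve. all: by end_near. Qed.

Let cvg_inv_sqrt (B : R) : (fun n => B / Num.sqrt (n%:R : R)) @ \oo --> 0.
Proof.
rewrite -(mulr0 B); apply: cvgM; first exact: cvg_cst.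
apply/cvgrPdist_le => e e0; near=> n.
have n2 : 2 <= Num.sqrt (n%:R : R) * e by near: n; exact: near_sqrt.
have s0 : 0 < Num.sqrt (n%:R : R) by rewrite -(pmulr_lgt0 _ e0)
  (lt_le_trans _ n2).
rewrite sub0r normrN ger0_norm ?invr_ge0 ?sqrtr_ge0//.
by rewrite -[leLHS]mul1r ler_pdivrMr// mulrC (le_trans _ n2)// ler1n.
Unshelve. all: by end_near. Qed.

Variable rho : nat -> planar_probability R.
Hypothesis rho_rate : gaussian_rate rho.

Lemma cvg_partial_self_energy z w : nonreal z -> nonreal w ->
  Ccvg (fun n => partial_self_energy (rho n) z w) (target z w).
Proof.
move=> nz nw; have [K1 K11 zK] := cone nz; have [K2 K21 wK] := cone nw.
(* The sum serves as one aperture for both variables. *)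
have K1K : 1 <= K1 + K2 by rewrite (le_trans K11)// lerDl (le_trans _ K21).
have [C C0 hC] := rho_rate K1K.
apply: (@Ccvg_squeeze _ _ _ (fun n => C * (\sum_(k < 4)
  ((normc z)^-1 ^+ k * (normc w)^-1 ^+ (3 - k)%N)) / Num.sqrt n%:R)).
  near=> n; rewrite mulrAC; apply: hC => //.
  - by near: n; exact: nbhs_infty_gt.
  - by near: n; apply: near_sqrt; exact: nonreal_gt0.
  - rewrite (le_trans zK)// ler_wpM2r// lerDl (le_trans _ K21)//.
  - by near: n; apply: near_sqrt; exact: nonreal_gt0.
  - rewrite (le_trans wK)// ler_wpM2r// lerDr (le_trans _ K11)//.
exact: cvg_inv_sqrt.
Unshelve. all: by end_near. Qed.

(** Makes the error independent of m: with y the inverse modulus of [iy m], its powers are at most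
    1. The two forms correspond to the variable that is sent to infinity. *)
Let sum_le (x y : R) : 0 <= x -> 0 <= y <= 1 ->
  \sum_(k < 4) (x ^+ k * y ^+ (3 - k)%N) <= \sum_(k < 4) x ^+ k /\
  \sum_(k < 4) (y ^+ k * x ^+ (3 - k)%N) <= \sum_(k < 4) x ^+ (3 - k)%N.
Proof.
move=> x0 /andP[y0 y1]; split; apply: ler_sum => k _.
  by rewrite ler_piMr ?exprn_ge0// exprn_ile1.
by rewrite ler_piMl ?exprn_ge0// exprn_ile1.
Qed.

Let invc_iy m : 0 <= (normc (iy m))^-1 <= 1.
Proof. by rewrite normc_iy invr_ge0 ler0n invf_le1 ?ltr0n// ler1n. Qed.

Let cone_iy m (K : R) : 1 <= K -> normc (iy m) <= K * `|Im (iy m)|.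
Proof. by move=> K1; rewrite normc_iy Im_iy ler_peMl. Qed.

Let sqrt_iy n m : 2 <= Num.sqrt (n%:R : R) * 1 ->
  2 <= Num.sqrt (n%:R : R) * `|Im (iy m)|.
Proof.
by move=> h; rewrite Im_iy (le_trans h)// ler_wpM2l ?sqrtr_ge0// ler1n.
Qed.

(** For fixed n the points w = [iy m] all satisfy the rate with the same bound B / sqrt n. Letting m
    tend to infinity replaces E(z,w) by its marginal term and the target by z^-2, while the bound
    survives up to a factor 2. *)
Lemma cvg_self_energy1 z : nonreal z ->
  Ccvg (fun n => z^-1 * self_energy (marginal1 (rho n)) z) (z ^+ 2)^-1.
Proof.
move=> nz; have [K K1 zK] := cone nz; have [C C0 hC] := rho_rate K1.
pose B := C * \sum_(k < 4) (normc z)^-1 ^+ k.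
apply: (@Ccvg_squeeze _ _ _ (fun n => (B + B) / Num.sqrt n%:R));
  last exact: cvg_inv_sqrt.
near=> n.
(* Since |Im (iy m)| >= 1, this one condition on n serves all m at once. *)
have n2 : 2 <= Num.sqrt (n%:R : R) * 1 by near: n; exact: near_sqrt.
have ct : Ccvg (target z \o iy) (z ^+ 2)^-1.
  have i0 := cvg_inv_iy (R := R).
  rewrite (_ : _ \o _ = fun m => (z ^+ 2)^-1 + (iy m)^-1 * (iy m)^-1
      + c%:C / z * (iy m)^-1).
    rewrite -[X in Ccvg _ X](_ : (z ^+ 2)^-1 + 0 * 0 + c%:C / z * 0 = _).
      apply: CcvgD; last by apply: CcvgM => //; exact: Ccvg_cst.
      by apply: CcvgD; [exact: Ccvg_cst|exact: CcvgM].
    by rewrite !mulr0 !addr0.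
  apply/funext => m; rewrite /target /=.
  by field; rewrite !nonreal_neq0.
have := CcvgB (cvg_partial_self_energy_marginal1 (rho n) nz) ct.
move/(@Ccvg_normc_le _ _ _ 0 (B / Num.sqrt n%:R)); rewrite subr0 mulrDl;
  apply=> m.
rewrite subr0; apply: le_trans (hC n z (iy m) _ nz _ zK (nonreal_iy m)
  (sqrt_iy m n2) (cone_iy m K1)) _.
- by near: n; exact: nbhs_infty_gt.
- by near: n; apply: near_sqrt; exact: nonreal_gt0.
- rewrite /B [leRHS]mulrAC ler_wpM2l ?divr_ge0 ?sqrtr_ge0 ?(ltW C0)//.
  have x0 : 0 <= (normc z)^-1 by rewrite invr_ge0 normc_ge0.
  by have [] := sum_le x0 (invc_iy m).
Unshelve. all: by end_near. Qed.

Lemma cvg_self_energy2 w : nonreal w ->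
  Ccvg (fun n => w^-1 * self_energy (marginal2 (rho n)) w) (w ^+ 2)^-1.
Proof.
move=> nw; have [K K1 wK] := cone nw; have [C C0 hC] := rho_rate K1.
pose B := C * \sum_(k < 4) (normc w)^-1 ^+ (3 - k)%N.
apply: (@Ccvg_squeeze _ _ _ (fun n => (B + B) / Num.sqrt n%:R));
  last exact: cvg_inv_sqrt.
near=> n.
have n2 : 2 <= Num.sqrt (n%:R : R) * 1 by near: n; exact: near_sqrt.
have ct : Ccvg (target ^~ w \o iy) (w ^+ 2)^-1.
  have i0 := cvg_inv_iy (R := R).
  rewrite (_ : _ \o _ = fun m => (iy m)^-1 * (iy m)^-1 + (w ^+ 2)^-1
      + c%:C / w * (iy m)^-1).
    rewrite -[X in Ccvg _ X](_ : 0 * 0 + (w ^+ 2)^-1 + c%:C / w * 0 = _).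
      apply: CcvgD; last by apply: CcvgM => //; exact: Ccvg_cst.
      by apply: CcvgD; [exact: CcvgM|exact: Ccvg_cst].
    by rewrite !mulr0 addr0 add0r.
  apply/funext => m; rewrite /target /=.
  by field; rewrite !nonreal_neq0.
have := CcvgB (cvg_partial_self_energy_marginal2 (rho n) nw) ct.
move/(@Ccvg_normc_le _ _ _ 0 (B / Num.sqrt n%:R)); rewrite subr0 mulrDl;
  apply=> m.
rewrite subr0; apply: le_trans (hC n (iy m) w _ (nonreal_iy m) (sqrt_iy m n2)
  (cone_iy m K1) nw _ wK) _.
- by near: n; exact: nbhs_infty_gt.
- by near: n; apply: near_sqrt; exact: nonreal_gt0.
- rewrite /B [leRHS]mulrAC ler_wpM2l ?divr_ge0 ?sqrtr_ge0 ?(ltW C0)//.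
  have x0 : 0 <= (normc w)^-1 by rewrite invr_ge0 normc_ge0.
  by have [] := sum_le x0 (invc_iy m).
Unshelve. all: by end_near. Qed.

End GaussianLimit.

(** * Convergence of the Cauchy transforms *)

Section CauchyLimit.
Context {R : realType} (c : R) (rho : nat -> planar_probability R).
Variable gamma : planar_probability R.
Hypothesis hg : bi_boolean_gaussian c gamma.
Hypothesis rho_rate : gaussian_rate c rho.
Implicit Types z w : R[i].

(** The general limit, applied to the constant sequence [gamma], becomes an equality by uniqueness
    of limits. *)
Let self_energy_gaussian1 z : nonreal z ->
  z^-1 * self_energy (marginal1 gamma) z = (z ^+ 2)^-1.
Proof.
move=> nz; apply: Ccvg_unique (cvg_self_energy1 (gaussian_rate_cst hg) nz).
exact: Ccvg_cst.
Qed.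

Let self_energy_gaussian2 z : nonreal z ->
  z^-1 * self_energy (marginal2 gamma) z = (z ^+ 2)^-1.
Proof.
move=> nz; apply: Ccvg_unique (cvg_self_energy2 (gaussian_rate_cst hg) nz).
exact: Ccvg_cst.
Qed.

(** Written with z^-1 * E, the quantity whose limit is known. *)
Let cauchyE (mu : probability R R) z : nonreal z ->
  cauchy mu z = (z * (1 - z^-1 * self_energy mu z))^-1.
Proof.
move=> nz; rewrite /self_energy mulrBr mulr1 mulrA mulfV ?nonreal_neq0//.
by rewrite mul1r opprB addrCA subrr addr0 invrK.
Qed.

Let Ccvg_cauchy (mu : nat -> probability R R) (mu' : probability R R) z :
  nonreal z -> cauchy mu' z != 0 ->
  Ccvg (fun n => z^-1 * self_energy (mu n) z) (z^-1 * self_energy mu' z) ->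
  Ccvg (fun n => cauchy (mu n) z) (cauchy mu' z).
Proof.
move=> nz g0 h; rewrite cauchyE// (_ : (fun n => _) =
    fun n => (z * (1 - z^-1 * self_energy (mu n) z))^-1); last first.
  by apply/funext => n; rewrite cauchyE.
(* The limit of the denominators is the inverse of [cauchy mu' z], hence nonzero. *)
apply: CcvgV; first by rewrite -invr_eq0 -cauchyE.
by apply: CcvgM; [exact: Ccvg_cst|apply: CcvgB => //; exact: Ccvg_cst].
Qed.

Let cvg_cauchy1 z : nonreal z ->
  Ccvg (fun n => cauchy (marginal1 (rho n)) z) (cauchy (marginal1 gamma) z).
Proof.
move=> nz; apply: Ccvg_cauchy => //; first exact: cauchy_marginal1_neq0.
by rewrite self_energy_gaussian1//; exact: (cvg_self_energy1 rho_rate nz).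
Qed.

Let cvg_cauchy2 z : nonreal z ->
  Ccvg (fun n => cauchy (marginal2 (rho n)) z) (cauchy (marginal2 gamma) z).
Proof.
move=> nz; apply: Ccvg_cauchy => //; first exact: cauchy_marginal2_neq0.
by rewrite self_energy_gaussian2//; exact: (cvg_self_energy2 rho_rate nz).
Qed.

Let cauchy2_selfE (mu : planar_probability R) z w : nonreal z -> nonreal w ->
  cauchy2 mu z w = (partial_self_energy mu z w + 1
    - z^-1 * self_energy (marginal1 mu) z - w^-1 * self_energy (marginal2 mu) w)
    * (cauchy (marginal1 mu) z * cauchy (marginal2 mu) w).
Proof.
move=> nz nw.
have g1 := cauchy_marginal1_neq0 mu nz; have g2 := cauchy_marginal2_neq0 mu nw.
rewrite /partial_self_energy.
rewrite (_ : _ + 1 - _ - _ = cauchy2 mu z w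
   / (cauchy (marginal1 mu) z * cauchy (marginal2 mu) w)); last by ring.
by rewrite divfK// mulf_neq0.
Qed.

Lemma cauchy2_cvg z w : nonreal z -> nonreal w ->
  Ccvg (fun n => cauchy2 (rho n) z w) (cauchy2 gamma z w).
Proof.
move=> nz nw; rewrite cauchy2_selfE// (_ : (fun n => _) = fun n =>
    (partial_self_energy (rho n) z w + 1
    - z^-1 * self_energy (marginal1 (rho n)) z
    - w^-1 * self_energy (marginal2 (rho n)) w)
    * (cauchy (marginal1 (rho n)) z * cauchy (marginal2 (rho n)) w));
      last first.
  by apply/funext => n; rewrite cauchy2_selfE.
apply: CcvgM; last by apply: CcvgM; [exact: cvg_cauchy1|exact: cvg_cauchy2].
rewrite hg// self_energy_gaussian1// self_energy_gaussian2//.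
apply: CcvgB; last exact: (cvg_self_energy2 rho_rate nw).
apply: CcvgB; last exact: (cvg_self_energy1 rho_rate nz).
by apply: CcvgD; [exact: (cvg_partial_self_energy rho_rate nz nw)|exact:
  Ccvg_cst].
Qed.

End CauchyLimit.

(** * The Poisson kernel *)

Section PoissonKernel.
Context {R : realType}.
Implicit Types e s u : R.
Local Notation leb := (@lebesgue_measure R).

(** The Poisson kernel of the half-plane without its factor 1/pi, that is, minus the imaginary part
    of 1/(u + i e). This accounts for the factors [pi ^+ 2] below. *)
Definition poisson (e u : R) : R := e / (u ^+ 2 + e ^+ 2).

Let den_gt0 e u : 0 < e -> 0 < u ^+ 2 + e ^+ 2.
Proof. by move=> e0; rewrite ltr_wpDl ?sqr_ge0// exprn_gt0. Qed.

Lemma poisson_ge0 e u : 0 < e -> 0 <= poisson e u.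
Proof. by move=> e0; rewrite divr_ge0 ?ltW// den_gt0. Qed.

Lemma poisson_le e u : 0 < e -> poisson e u <= e^-1.
Proof.
move=> e0; rewrite /poisson ler_pdivrMr ?den_gt0// mulrDr.
rewrite (expr2 e) mulKf ?gt_eqF// lerDr.
by rewrite mulr_ge0 ?invr_ge0 ?sqr_ge0 ?ltW.
Qed.

Lemma continuous_poisson e : 0 < e -> continuous (poisson e).
Proof.
move=> e0 u; apply: cvgM; first exact: cvg_cst.
apply: cvgV; first by rewrite gt_eqF// den_gt0.
by apply: cvgD; [exact: exprn_continuous|exact: cvg_cst].
Qed.

Lemma measurable_poisson e : 0 < e -> measurable_fun setT (poisson e).
Proof. by move=> e0; apply: continuous_measurable_fun;
  exact: continuous_poisson. Qed.

Let poisson1E u : poisson 1 u = (1 + u ^+ 2)^-1.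
Proof. by rewrite /poisson expr1n mul1r addrC. Qed.

Lemma integral_poisson1 : (\int[leb]_u (poisson 1 u)%:E = pi%:E)%E.
Proof.
rewrite ge0_symfun_integralT.
- rewrite -set_itvcy (@ge0_continuous_FTC2y _ _ (@atan R) 0 (pi / 2)).
  + by rewrite atan0 sube0 -EFinM; congr EFin; field.
  + by move=> x _; exact: poisson_ge0.
  + by apply: continuous_subspaceT; exact: continuous_poisson.
  + exact: cvgy_atan.
  + by move=> x _; exact: derivable_atan.
  + by apply: cvg_at_right_filter; exact: continuous_atan.
  + by move=> x _; rewrite derive1_atan poisson1E.
- by move=> x; exact: poisson_ge0.
- exact: continuous_poisson.
- by move=> x /=; rewrite /poisson sqrrN.
Qed.

Lemma integral_poisson e s : 0 < e -> (\int[leb]_x (poisson e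
  (x - s))%:E = pi%:E)%E.
Proof.
move=> e0; pose F := fun x : R => e * x + s.
have dF (x : R) : is_derive x (1 : R) F e.
  by rewrite /F; apply: is_derive_eq; rewrite addr0 /GRing.scale/= mulr1.
have F'E : derive1 F = cst e by apply/funext => x; rewrite derive1E derive_val.
rewrite (@increasing_ge0_integration_by_substitutionT _ F).
- rewrite F'E -integral_poisson1; apply: eq_integral => x _; congr EFin.
  transitivity (poisson e (e * x + s - s) * e) => //.
  rewrite addrK /poisson !expr1n exprMn.
  have n0 : x ^+ 2 + 1 != 0 by rewrite gt_eqF// ltr_wpDl ?sqr_ge0.
  by field; rewrite n0 gt_eqF// den_gt0.
- by move=> x y xy; rewrite /F ltrD2r ltr_pM2l.
- by rewrite F'E => x; exact: cvg_cst.
- by rewrite F'E; exact: is_cvg_cst.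
- by rewrite F'E; exact: is_cvg_cst.
- by move=> x; exact: ex_derive.
- apply: (@cvg_comp _ _ _ (fun x => e * x) (+%R^~ s) _ (-oo%R));
  last exact: cvg_addrr_Ny.
  by apply: gt0_cvgMrNy => //; exact: cvg_id.
- apply: (@cvg_comp _ _ _ (fun x => e * x) (+%R^~ s) _ (+oo%R));
  last exact: cvg_addrr.
  by apply: gt0_cvgMry => //; exact: cvg_id.
- move=> x; apply: (@continuous_comp _ _ _ (fun x => x - s)).
    by apply: cvgB; [exact: cvg_id|exact: cvg_cst].
  exact: continuous_poisson.
- by move=> x; exact: poisson_ge0.
Qed.

End PoissonKernel.

Lemma ler_dist4 (R : realDomainType) (a b a' b' x y z : R) :
  `|a - a'| <= x -> `|b - b'| <= y -> `|a' - b'| <= z -> `|a - b| <= x + y + z.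
Proof.
rewrite !ler_norml => /andP[? ?] /andP[? ?] /andP[? ?].
by apply/andP; split; lra.
Qed.

(** Sections are integrable at every point, not just almost everywhere, so all inner integrals are
    finite and the extended-real statement descends to real-valued integrals. *)
Lemma Rintegral_Fubini d1 d2 (S : measurableType d1) (T : measurableType d2)
    (R : realType) (P : {sigma_finite_measure set S -> \bar R})
    (m : {sigma_finite_measure set T -> \bar R}) (F : S * T -> R) :
  (P \x m)%E.-integrable setT (EFin \o F) ->
  (forall p, m.-integrable setT (EFin \o (fun x => F (p, x)))) ->
  (forall x, P.-integrable setT (EFin \o (fun p => F (p, x)))) ->
  [/\ measurable_fun setT (fun p => \int[m]_x F (p, x)),
      measurable_fun setT (fun x => \int[P]_p F (p, x))
    & \int[P]_p \int[m]_x F (p, x) = \int[m]_x \int[P]_p F (p, x)].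
Proof.
move=> iF iF1 iF2.
have E1 p : (\int[m]_x (F (p, x))%:E)%E = (\int[m]_x F (p, x))%:E.
  by rewrite fineK//; exact: (integrable_fin_num measurableT (iF1 p)).
have E2 x : (\int[P]_p (F (p, x))%:E)%E = (\int[P]_p F (p, x))%:E.
  by rewrite fineK//; exact: (integrable_fin_num measurableT (iF2 x)).
split.
- apply/measurable_EFinP.
  have -> : EFin \o (fun p => \int[m]_x F (p, x)) = fubini_F m (EFin \o F).
    by apply/funext => p; exact: esym (E1 p).
  exact: (measurable_fubini_F iF).
- apply/measurable_EFinP.
  have -> : EFin \o (fun x => \int[P]_p F (p, x)) = fubini_G P (EFin \o F).
    by apply/funext => x; exact: esym (E2 x).
  exact: (measurable_fubini_G iF).
- rewrite /Rintegral; congr fine.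
  under eq_integral do rewrite -E1.
  under [RHS]eq_integral do rewrite -E2.
  exact: (Fubini iF).
Qed.

(** * Poisson smoothing of functions on the plane *)

Section Smoothing.
Context {d} {T : measurableType d} {R : realType}.
Variable m : {sigma_finite_measure set T -> \bar R}.
Variables X Y : T -> R.
Hypothesis mX : measurable_fun setT X.
Hypothesis mY : measurable_fun setT Y.

(** The two widths are independent because the error estimate trades a factor of width e for one of
    width 1 in a single coordinate. *)
Let K (e e' : R) (p : R * R) (x : T) :=
  poisson e (X x - p.1) * poisson e' (Y x - p.2).

Hypothesis integral_K : forall (e e' : R) p, 0 < e -> 0 < e' ->
  (\int[m]_x (K e e' p x)%:E = (pi ^+ 2)%:E)%E.

Let K_ge0 e e' p x : 0 < e -> 0 < e' -> 0 <= K e e' p x.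
Proof. by move=> e0 e'0; rewrite mulr_ge0 ?poisson_ge0. Qed.

Let measurable_K (e e' : R) : 0 < e -> 0 < e' ->
  measurable_fun setT (fun q : (R * R) * T => K e e' q.1 q.2).
Proof.
move=> e0 e'0; apply: measurable_funM.
- apply: (measurableT_comp (measurable_poisson e0)); apply: measurable_funB.
    by apply: (measurableT_comp mX); exact: measurable_snd.
  by apply: (measurableT_comp measurable_fst); exact: measurable_fst.
- apply: (measurableT_comp (measurable_poisson e'0)); apply: measurable_funB.
    by apply: (measurableT_comp mY); exact: measurable_snd.
  by apply: (measurableT_comp measurable_snd); exact: measurable_fst.
Qed.

Let measurable_K1 e e' p : 0 < e -> 0 < e' -> measurable_fun setT (K e e' p).
Proof.
move=> e0 e'0.
exact: (measurableT_comp (measurable_K e0 e'0) (measurable_pair1 p)).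
Qed.

Let measurable_K2 e e' x : 0 < e -> 0 < e' ->
  measurable_fun setT (fun p => K e e' p x).
Proof.
move=> e0 e'0.
exact: (measurableT_comp (measurable_K e0 e'0) (measurable_pair2 x)).
Qed.

Let integrable_K e e' p : 0 < e -> 0 < e' -> m.-integrable setT
  (EFin \o K e e' p).
Proof.
move=> e0 e'0; apply/integrableP; split;
  first exact/measurable_EFinP/measurable_K1.
under eq_integral do rewrite /= ger0_norm ?K_ge0//.
by rewrite integral_K// ltry.
Qed.

Let Rintegral_K e e' p : 0 < e -> 0 < e' -> \int[m]_x K e e' p x = pi ^+ 2.
Proof. by move=> e0 e'0; rewrite /Rintegral integral_K. Qed.

(** This is u^2/(1 + u^2): bounded, bounded away from 0 off each neighbourhood of 0, and small
    against a narrow kernel, since b u * poisson e u is e * poisson 1 u times u^2/(u^2 + e^2). *)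
Let b (u : R) := u ^+ 2 * poisson 1 u.

Let b_poisson e u : 0 < e -> b u * poisson e u <= e * poisson 1 u.
Proof.
move=> e0; rewrite /b mulrAC ler_wpM2r ?poisson_ge0//.
have n0 : 0 < u ^+ 2 + e ^+ 2 by rewrite ltr_wpDl ?sqr_ge0// exprn_gt0.
by rewrite /poisson mulrCA ler_piMr ?(ltW e0)// ler_pdivrMr//
  mul1r lerDl sqr_ge0.
Qed.

Variables (g : R * R -> R) (M : R).
Hypothesis mg : measurable_fun setT g.
Hypothesis M0 : 0 <= M.
Hypothesis gM : forall p, `|g p| <= M * (poisson 1 p.1 * poisson 1 p.2).
(** Uniform continuity in a form that integrates directly against [K], with no splitting into near
    and far points. *)
Hypothesis g_unif : forall eta : R, 0 < eta -> exists2 C, 0 <= C &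
  forall p q, `|g q - g p| <= eta + C * (b (q.1 - p.1) + b (q.2 - p.2)).

Let gXY x := g (X x, Y x).

Let measurable_gXY : measurable_fun setT gXY.
Proof. by apply: (measurableT_comp mg); exact: measurable_fun_pair. Qed.

Let g_le p : `|g p| <= M.
Proof.
rewrite (le_trans (gM p))// ler_piMr//.
by rewrite -[leRHS]mulr1 ler_pM ?poisson_ge0// (le_trans (poisson_le _ _))//
  invr1.
Qed.

Let integrable_gXY : m.-integrable setT (EFin \o gXY).
Proof.
apply: (le_integrable measurableT _ _ (integrableZl measurableT M
  (integrable_K (0, 0) ltr01 ltr01))).
  exact/measurable_EFinP.
move=> x _; rewrite -EFinM !abse_EFin lee_fin.
rewrite [leRHS]ger0_norm; last by rewrite mulr_ge0// K_ge0.
by rewrite /K !subr0; exact: gM.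
Qed.

Let smooth (e : R) (p : R * R) := \int[m]_x (gXY x * K e e p x).

Let integrable_gK e p : 0 < e ->
  m.-integrable setT (EFin \o (fun x => gXY x * K e e p x)).
Proof.
move=> e0; apply: (le_integrable measurableT _ _ (integrableZl measurableT M
  (integrable_K p e0 e0))).
  by apply/measurable_EFinP/measurable_funM => //; exact: measurable_K1.
move=> x _; rewrite -EFinM !abse_EFin lee_fin !normrM.
by rewrite ler_pM// (le_trans (g_le _))// ler_norm.
Qed.

(** As the kernel has mass pi^2, the difference is the integral of (g(x) - g(p)) K. By [g_unif] and
    [b_poisson] it is dominated by eta/2 times a kernel plus C e times two kernels, each again of
    mass pi^2. *)
Let smooth_close (eta : R) : 0 < eta -> exists2 e : R, 0 < e &
  forall p, `|smooth e p - pi ^+ 2 * g p| <= pi ^+ 2 * eta.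
Proof.
move=> eta0; have eta2 : 0 < eta / 2 by rewrite divr_gt0.
have [C C0 hC] := g_unif eta2.
have D0 : 0 < 2 * C + 1 by rewrite ltr_wpDl// mulr_ge0.
(* Makes 2 C e at most eta/2; the 1 covers C = 0. *)
pose e := (eta / 2) / (2 * C + 1).
have e0 : 0 < e by rewrite divr_gt0.
have eC : eta / 2 + C * (e + e) <= eta.
  have : e * (2 * C + 1) = eta / 2 by rewrite divfK// gt_eqF.
  by move: e0; nra.
exists e => // p.
have igp : m.-integrable setT (EFin \o (fun x => g p * K e e p x)).
  exact: (integrableZl measurableT (g p) (integrable_K p e0 e0)).
rewrite -(Rintegral_K p e0 e0) [_ * g p]mulrC -RintegralZl//;
  last exact: integrable_K.
rewrite -RintegralB//; last exact: integrable_gK.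
have ih : m.-integrable setT (EFin \o (fun x => eta / 2 * K e e p x
    + C * e * (K 1 e p x + K e 1 p x))).
  have i1 := integrableD measurableT (integrable_K p ltr01 e0)
    (integrable_K p e0 ltr01).
  have i2 := integrableZl measurableT (C * e) i1.
  exact: (integrableD measurableT
    (integrableZl measurableT (eta / 2) (integrable_K p e0 e0)) i2).
have idiff : m.-integrable setT (EFin \o (fun x =>
  gXY x * K e e p x - g p * K e e p x)).
  exact: (integrableB measurableT (integrable_gK p e0) igp).
apply: le_trans (le_normr_Rintegral measurableT idiff) _.
apply: (@le_trans _ _ (\int[m]_x (eta / 2 * K e e p x
    + C * e * (K 1 e p x + K e 1 p x)))).
  apply: le_Rintegral => //; first exact: integrable_norm.
  move=> x _; rewrite -mulrBl normrM (ger0_norm (K_ge0 _ _ e0 e0)).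
  apply: (@le_trans _ _ ((eta / 2 + C * (b (X x - p.1) + b
    (Y x - p.2))) * K e e p x)).
    by rewrite ler_wpM2r ?K_ge0//; exact: (hC p (X x, Y x)).
  have h1 : b (X x - p.1) * K e e p x <= e * K 1 e p x.
    by rewrite /K [leLHS]mulrA [leRHS]mulrA ler_wpM2r ?poisson_ge0//;
      exact: b_poisson.
  have h2 : b (Y x - p.2) * K e e p x <= e * K e 1 p x.
    by rewrite /K mulrCA [leRHS]mulrCA ler_wpM2l ?poisson_ge0//;
      exact: b_poisson.
  rewrite mulrDl lerD2l -[leLHS]mulrA -[leRHS]mulrA ler_wpM2l//.
  by rewrite mulrDl [leRHS]mulrDr lerD.
have i11 := integrable_K p ltr01 e0.
have i12 := integrable_K p e0 ltr01.
have ee := integrable_K p e0 e0.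
have i1 : m.-integrable setT (EFin \o (fun x => K 1 e p x + K e 1 p x)).
  exact: (integrableD measurableT i11 i12).
rewrite RintegralD//; last 2 first.
  exact: (integrableZl measurableT (eta / 2) ee).
  exact: (integrableZl measurableT (C * e) i1).
rewrite !RintegralZl// RintegralD// !Rintegral_K//.
rewrite (_ : _ + _ = pi ^+ 2 * (eta / 2 + C * (e + e))); last by ring.
by rewrite ler_wpM2l ?sqr_ge0.
Qed.

(** Moves the probability onto the kernel, whose integrals are determined by Cauchy transforms. *)
Let smooth_Fubini (e : R) (P : probability (R * R)%type R) : 0 < e ->
  [/\ measurable_fun setT (smooth e),
      measurable_fun setT (fun x => gXY x * \int[P]_p K e e p x)
    & \int[P]_p smooth e p = \int[m]_x (gXY x * \int[P]_p K e e p x)].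
Proof.
move=> e0; pose F (q : (R * R) * T) := gXY q.2 * K e e q.1 q.2.
have mF : measurable_fun setT F.
  apply: measurable_funM; last exact: measurable_K.
  by apply: (measurableT_comp measurable_gXY); exact: measurable_snd.
have iK2 x : P.-integrable setT (EFin \o (fun p => K e e p x)).
  apply: (@integrable_bounded _ _ _ P _ (e^-1 * e^-1));
    first exact: measurable_K2.
  by move=> p; rewrite ger0_norm ?K_ge0// ler_pM ?poisson_ge0 ?poisson_le.
have iF1 p : m.-integrable setT (EFin \o (fun x =>
  F (p, x))) by exact: integrable_gK.
have iF2 x : P.-integrable setT (EFin \o (fun p => F (p, x))).
  exact: (integrableZl measurableT (gXY x) (iK2 x)).
(* The inner integral of |F| is at most M pi^2 for every p, and P has mass 1. *)
have iF : (P \x m)%E.-integrable setT (EFin \o F).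
  apply/integrable12ltyP; first exact/measurable_EFinP.
  apply: (@le_lt_trans _ _ (\int[P]_p (M * pi ^+ 2)%:E)%E); last first.
    by rewrite integral_cst// [X in (_ * X)%E]probability_setT mule1 ltry.
  apply: ge0_le_integral => //.
  - by move=> p _; exact: integral_ge0.
  - apply: (@measurable_fun_fubini_tonelli_F _ _ _ _ _ m (abse \o EFin \o F)) =>
    //.
    + by apply: measurableT_comp => //; exact/measurable_EFinP.
    + by move=> q; exact: abse_ge0.
  move=> p _; apply: (@le_trans _ _ (\int[m]_x (M * K e e p x)%:E)%E).
    apply: ge0_le_integral => //.
    - by apply: measurableT_comp => //; case/integrableP : (iF1 p).
    - by apply/measurable_EFinP; apply: measurable_funM => //;
      exact: measurable_K1.
    - move=> x _; rewrite /= lee_fin normrM (ger0_norm (K_ge0 _ _ e0 e0)).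
      by rewrite ler_wpM2r ?K_ge0//; exact: g_le.
  under eq_integral do rewrite EFinM.
  by rewrite integralZl//; [rewrite integral_K|exact: integrable_K].
have [mS mS2 FS] := Rintegral_Fubini iF iF1 iF2.
have FE x : \int[P]_p F (p, x) = gXY x * \int[P]_p K e e p x.
  by rewrite -(RintegralZl (gXY x) measurableT (iK2 x)).
split; first exact: mS.
- by rewrite (_ : (fun x => _) = fun x => \int[P]_p F (p, x))//; apply/funext.
- rewrite -[LHS]/(\int[P]_p \int[m]_x F (p, x)) FS.
  by apply: eq_Rintegral => x _; exact: FE.
Qed.

Let smooth_bounded e p : 0 < e -> `|smooth e p| <= M * pi ^+ 2.
Proof.
move=> e0; apply: le_trans (le_normr_Rintegral measurableT
  (integrable_gK p e0)) _.
rewrite -(Rintegral_K p e0 e0) -RintegralZl//; last exact: integrable_K.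
apply: le_Rintegral => //.
- exact: (integrable_norm (integrable_gK p e0)).
- exact: (integrableZl measurableT M (integrable_K p e0 e0)).
- move=> x _; rewrite normrM (ger0_norm (K_ge0 _ _ e0 e0)).
  by rewrite ler_wpM2r ?K_ge0//; exact: g_le.
Qed.

Let integral_smooth_close eta e (P : probability (R * R)%type R) : 0 < e ->
  (forall p, `|smooth e p - pi ^+ 2 * g p| <= pi ^+ 2 * eta) ->
  `|\int[P]_p smooth e p - pi ^+ 2 * \int[P]_p g p| <= pi ^+ 2 * eta.
Proof.
move=> e0 h.
have ig : P.-integrable setT (EFin \o g) by exact: integrable_bounded g_le.
have iS : P.-integrable setT (EFin \o smooth e).
  apply: (@integrable_bounded _ _ _ P _ (M * pi ^+ 2)).
    by have [] := smooth_Fubini P e0.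
  by move=> p; exact: smooth_bounded.
have iD : P.-integrable setT (EFin \o (fun p => smooth e p - pi ^+ 2 * g p)).
  exact: (integrableB measurableT iS (integrableZl measurableT (pi ^+ 2) ig)).
rewrite -RintegralZl// -RintegralB//; last first.
  exact: (integrableZl measurableT (pi ^+ 2) ig).
apply: le_trans (le_normr_Rintegral measurableT iD) _.
rewrite -[leRHS](Rintegral_probability_cst P); apply: le_Rintegral => //.
- exact: integrable_norm.
- exact: finite_measure_integrable_cst.
Qed.

(** The smoothing error is the same for all probabilities, so a three-term estimate leaves the
    integrals of [smooth e] for one fixed e. After the exchange of integrals these converge by
    dominated convergence in x, under the integrable bound e^-2 |g|. *)
Lemma cvg_integral_of_cvg_poisson (P : nat -> probability (R * R)%type R)
    (P' : probability (R * R)%type R) :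
  (forall e x, 0 < e ->
    (fun n => \int[P n]_p K e e p x) @ \oo --> \int[P']_p K e e p x) ->
  (fun n => \int[P n]_p g p) @ \oo --> \int[P']_p g p.
Proof.
move=> h; apply/cvgrPdist_le => eta eta0.
have eta3 : 0 < eta / 3 by rewrite divr_gt0.
have pi20 : 0 < pi ^+ 2 :> R by rewrite exprn_gt0// pi_gt0.
have [e e0 he] := smooth_close eta3.
have cS : (fun n => \int[P n]_p smooth e p) @ \oo --> \int[P']_p smooth e p.
  have [_ mP' ->] := smooth_Fubini P' e0.
  rewrite (_ : (fun n => _) =
    fun n => \int[m]_x (gXY x * \int[P n]_p K e e p x)); last first.
    by apply/funext => n; have [] := smooth_Fubini (P n) e0.
  have KP (Q : probability (R * R)%type R) x : 0 <= \int[Q]_p K e e p x <= e^-1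
    * e^-1.
    rewrite Rintegral_ge0/=; last by move=> p _; rewrite K_ge0.
    rewrite -[leRHS](Rintegral_probability_cst Q); apply: le_Rintegral => //.
    - apply: (@integrable_bounded _ _ _ Q _ (e^-1 * e^-1));
      first exact: measurable_K2.
      by move=> p; rewrite ger0_norm ?K_ge0// ler_pM ?poisson_ge0 ?poisson_le.
    - exact: finite_measure_integrable_cst.
    - by move=> p _; rewrite ler_pM ?poisson_ge0 ?poisson_le.
  apply: (@Rintegral_dominated_cvg _ _ _ m _ _ (fun x =>
    e^-1 * e^-1 * `|gXY x|)).
  - by move=> n; have [] := smooth_Fubini (P n) e0.
  - exact: mP'.
  - by move=> x; apply: cvgM; [exact: cvg_cst|exact: h].
  - exact: (integrableZl measurableT _ (integrable_norm integrable_gXY)).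
  - move=> n x; have /andP[k0 k1] := KP (P n) x.
    by rewrite normrM mulrC ler_pM// ger0_norm.
move/cvgrPdist_le : cS => /(_ (pi ^+ 2 * (eta / 3))) cS.
near=> n.
have c1 := integral_smooth_close P' e0 he.
have c2 := integral_smooth_close (P n) e0 he.
have c3 : `|\int[P']_p smooth e p - \int[P n]_p smooth e p| <= pi ^+ 2 *
  (eta / 3).
  by near: n; apply: cS; rewrite mulr_gt0.
rewrite -(ler_pM2l pi20) -[X in X * `|_|](ger0_norm (ltW pi20)) -normrM mulrBr.
rewrite distrC in c1; rewrite distrC in c2.
apply: le_trans (ler_dist4 c1 c2 c3) _.
by rewrite le_eqVlt; apply/orP; left; apply/eqP; field.
Unshelve. all: by end_near. Qed.

End Smoothing.

(** * Continuous functions on the plane *)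

Section PlaneFunctions.
Context {R : realType}.
Implicit Types (p q : R * R) (f g : R * R -> R).

Lemma plane_ballE p (r : R) q :
  ball p r q <-> `|p.1 - q.1| < r /\ `|p.2 - q.2| < r.
Proof. by rewrite /ball/= /prod_ball -ball_normE. Qed.

(** Connects the topology of the plane with its product sigma-algebra: an open set is the union of
    the countably many rational rectangles that it contains. *)
Lemma open_measurable_plane (U : set (R * R)) : open U -> measurable U.
Proof.
move=> oU.
pose B (a : rat * rat * (rat * rat)) : set (R * R) :=
  `]ratr a.1.1, ratr a.1.2[%classic `*` `]ratr a.2.1, ratr a.2.2[%classic.
rewrite (_ : U = \bigcup_a (if `[< B a `<=` U >] then B a else set0)).
  apply: countable_bigcupT_measurable; first exact: countableP.
  move=> a; case: ifPn => // _; exact: measurableX.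
apply/seteqP; split => [p Up|p [a _]]; last by case: asboolP => // + Bp; apply.
have /nbhs_ballP[r /= r0 rU] : nbhs p U by exact: open_nbhs_nbhs.
have itv (x : R) : exists2 ab : rat * rat, ratr ab.1 < x < ratr ab.2 &
    forall y, ratr ab.1 < y < ratr ab.2 -> `|x - y| < r.
  have [a /[!in_itv]/= /andP[xa ax]] := @rat_in_itvoo R (x - r) x ltac:(lra).
  have [b /[!in_itv]/= /andP[xb bx]] := @rat_in_itvoo R x (x + r) ltac:(lra).
  by exists (a, b) => /= [|y /andP[]]; [rewrite ax xb|rewrite ltr_norml; lra].
have [a a1 a2] := itv p.1; have [b b1 b2] := itv p.2.
exists (a, b) => //; rewrite ifT; first by split; rewrite /= in_itv.
apply/asboolP => q /= []; rewrite /= !in_itv/= => q1 q2.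
by apply: rU; apply/plane_ballE; split; [exact: a2|exact: b2].
Qed.

Lemma continuous_measurable_plane f : continuous f -> measurable_fun setT f.
Proof.
move=> /continuousP cf; apply: (measurability _ (RGenOpens.measurableE R)).
move=> _ [_ [a [b ->] <-]]; rewrite setTI; apply: open_measurable_plane.
exact/cf/interval_open.
Qed.

(** Heine-Cantor on the box that carries g; covering the box gives a common radius for p in the box
    and q anywhere. *)
Lemma plane_unif_continuous g (A : R) : continuous g ->
  (forall p, g p != 0 -> `|p.1| <= A /\ `|p.2| <= A) ->
  forall eta : R, 0 < eta -> exists2 del : R, 0 < del & forall p q,
    `|p.1 - q.1| < del -> `|p.2 - q.2| < del -> `|g q - g p| <= eta.
Proof.
move=> cg g0 eta eta0.
pose box : set (R * R) := `[- A, A]%classic `*` `[- A, A]%classic.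
have cbox : compact box by apply: compact_setX; exact: segment_compact.
have boxP p : g p != 0 -> box p.
  by move=> /g0[]; rewrite !ler_norml => h1 h2; split; rewrite /= in_itv.
have near_box : \forall del \near (0 : R)^'+, box `<=` (fun p => forall q,
    `|p.1 - q.1| < del -> `|p.2 - q.2| < del -> `|g q - g p| <= eta).
  apply: (proj1 (compact_near_coveringP box) cbox) => p _.
  have eta2 : 0 < eta / 2 by rewrite divr_gt0.
  have /cvgrPdist_le /(_ _ eta2) /nbhs_ballP[r /= r0 hr] := cg p.
  have r2 : 0 < r / 2 by rewrite divr_gt0.
  (* With p' within r/2 of p and q within r/2 of p', both lie in the ball where g differs from g p
     by at most eta/2. *)
  exists (ball p (r / 2), [set del | del < r / 2]) => /=.
    split; first exact: nbhsx_ballx.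
    by apply: nbhs_right_lt.
  move=> [p' del] /= [/plane_ballE[pp1 pp2] dr] q q1 q2.
  have hp' : `|g p - g p'| <= eta / 2.
    by apply: hr; apply/plane_ballE; split; lra.
  have hq : `|g p - g q| <= eta / 2.
    apply: hr; apply/plane_ballE; move: pp1 pp2 q1 q2.
    by rewrite !ltr_norml => h1 h2 h3 h4; split; lra.
  by move: hp' hq; rewrite !ler_norml; lra.
have [del [del0 hdel]] : exists del : R, 0 < del /\
    box `<=` (fun p => forall q,
      `|p.1 - q.1| < del -> `|p.2 - q.2| < del -> `|g q - g p| <= eta).
  near (0 : R)^'+ => del; exists del; split; near: del => //.
  exact: nbhs_right_gt.
exists del => // p q h1 h2.
(* If p is outside the support, either q is too and the difference is 0, or q lies in the box and
   the two exchange roles. *)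
have [gp|/boxP bp] := eqVneq (g p) 0; last exact: (hdel p bp q).
have [gq|/boxP bq] := eqVneq (g q) 0.
  by rewrite gp gq subrr normr0 ltW.
by rewrite distrC; apply: (hdel q bq p); rewrite distrC.
Unshelve. all: by end_near. Qed.

(** On |u| <= A the kernel [poisson 1 u] is at least 1/(1 + A^2), one such factor for each
    coordinate. *)
Lemma plane_poisson_dominated g (A B : R) : 0 <= B -> (forall p, `|g p| <= B) ->
  (forall p, g p != 0 -> `|p.1| <= A /\ `|p.2| <= A) ->
  forall p, `|g p| <= B * (1 + A ^+ 2) ^+ 2 * (poisson 1 p.1 * poisson 1 p.2).
Proof.
move=> B0 gB g0 p.
have [->|/g0[p1 p2]] := eqVneq (g p) 0.
  rewrite normr0; apply: mulr_ge0.
    by apply: mulr_ge0 => //; exact: sqr_ge0.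
  by apply: mulr_ge0; apply: poisson_ge0.
rewrite (le_trans (gB p))// -mulrA ler_peMr//.
have key u : `|u| <= A -> 1 <= (1 + A ^+ 2) * poisson 1 u.
  move=> uA; rewrite /poisson expr1n mul1r ler_pdivlMr ?ltr_wpDl ?sqr_ge0//.
  rewrite mul1r addrC lerD2l -(ger0_norm (sqr_ge0 u)) normrX.
  by rewrite lerXn2r ?nnegrE// (le_trans _ uA).
rewrite expr2 mulrACA -[leLHS]mulr1 ler_pM//; exact: key.
Qed.

(** Below the radius [del] uniform continuity suffices. Otherwise some coordinate differs by at
    least [del]; u^2/(1 + u^2) grows with |u|, so its value there is at least [b1], and C = 2 B / b1
    makes the second term exceed the trivial bound 2 B. *)
Lemma plane_poisson_modulus g (A B : R) : continuous g ->
  0 <= B -> (forall p, `|g p| <= B) ->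
  (forall p, g p != 0 -> `|p.1| <= A /\ `|p.2| <= A) ->
  forall eta : R, 0 < eta -> exists2 C, 0 <= C & forall p q,
    `|g q - g p| <= eta + C * ((q.1 - p.1) ^+ 2 * poisson 1 (q.1 - p.1)
                             + (q.2 - p.2) ^+ 2 * poisson 1 (q.2 - p.2)).
Proof.
move=> cg B0 gB g0 eta eta0.
have [del del0 hdel] := plane_unif_continuous cg g0 eta0.
pose b (u : R) := u ^+ 2 * poisson 1 u.
have b0 u : 0 <= b u by apply: mulr_ge0; [exact: sqr_ge0|exact: poisson_ge0].
pose b1 := del ^+ 2 * poisson 1 del.
have p1E u : poisson 1 u = (u ^+ 2 + 1)^-1 by rewrite /poisson expr1n mul1r.
have n0 (u : R) : 0 < u ^+ 2 + 1 by rewrite ltr_wpDl ?sqr_ge0.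
have b10 : 0 < b1 by rewrite /b1 p1E mulr_gt0 ?exprn_gt0// invr_gt0.
have bb u : del <= `|u| -> b1 <= b u.
  move=> du; rewrite /b1 /b !p1E ler_pdivrMr// mulrAC ler_pdivlMr//.
  rewrite !mulrDr !mulr1 [X in _ <= X + _]mulrC lerD2l.
  by rewrite -(real_normK (num_real u)); apply: lerXn2r; rewrite ?nnegrE// ltW.
have B1 : 0 <= 2 * B / b1 by apply: divr_ge0; [exact: mulr_ge0|exact: ltW].
exists (2 * B / b1) => // p q.
have big : `|g q - g p| <= 2 * B.
  by rewrite (le_trans (ler_normB _ _))// mulr2n mulrDl mul1r lerD.
rewrite -/(b _) -/(b _).
have far u v : del <= `|u| -> 0 <= v -> 2 * B <= 2 * B / b1 * (b u + v).
  move=> du v0; rewrite -mulrA ler_peMr ?mulr_ge0// mulrC ler_pdivlMr// mul1r.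
  by rewrite (le_trans (bb _ du))// lerDl.
have [d1|d1] := ltP `|p.1 - q.1| del; last first.
  rewrite (le_trans big)// (le_trans (far (q.1 - p.1) (b (q.2 - p.2)) _ _))//.
    by rewrite distrC.
  by rewrite lerDr ltW.
have [d2|d2] := ltP `|p.2 - q.2| del; last first.
  rewrite [b _ + _]addrC (le_trans big)//
    (le_trans (far (q.2 - p.2) (b (q.1 - p.1)) _ _))//.
    by rewrite distrC.
  by rewrite lerDr ltW.
rewrite (le_trans (hdel _ _ d1 d2))// lerDl.
by apply: mulr_ge0 => //; exact: addr_ge0.
Qed.

End PlaneFunctions.

(* The product of two sigma-finite measures is not found to be sigma-finite by
   unification, the product of two subprobabilities shadowing it. *)
Section PlaneLebesgue.
Context {R : realType}.

Let leb : {sigma_finite_measure set (measurableTypeR R) -> \bar R} :=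
  @lebesgue_measure R.

Definition plane_lebesgue :
    set (measurableTypeR R * measurableTypeR R)%type -> \bar R :=
  (leb \x leb)%E.

HB.instance Definition _ := Measure.on plane_lebesgue.

Let sigma_finite_plane_lebesgue : sigma_finite setT plane_lebesgue.
Proof.
have /sigma_finiteP[F [FT ndF Foo]] := sigma_finiteT leb.
exists (fun n => F n `*` F n) => [|n].
  apply/seteqP; split => // -[x y] _.
  have [i _ Fx] : (\bigcup_i F i) x by rewrite -FT.
  have [j _ Fy] : (\bigcup_i F i) y by rewrite -FT.
  exists (maxn i j) => //; split => /=.
    by move: x Fx; apply/subsetPset/ndF/leq_maxl.
  by move: y Fy; apply/subsetPset/ndF/leq_maxr.
have [mF Fn] := Foo n; split; first exact: measurableX.
by rewrite [ltLHS]product_measure1E// lte_mul_pinfty// ge0_fin_numE.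
Qed.

HB.instance Definition _ := @Measure_isSigmaFinite.Build _ _ _ plane_lebesgue
  sigma_finite_plane_lebesgue.

End PlaneLebesgue.

(** * From Cauchy transforms to weak convergence *)

Section StieltjesInversion.
Context {R : realType}.
Implicit Types (p q : R * R) (P : planar_probability R).

Let leb2 : {sigma_finite_measure set
  (measurableTypeR R * measurableTypeR R)%type
  -> \bar R} := @plane_lebesgue R.
Let X (x : measurableTypeR R * measurableTypeR R) : R := x.1.
Let Y (x : measurableTypeR R * measurableTypeR R) : R := x.2.

Let mX : measurable_fun setT X. Proof. exact: measurable_fst. Qed.
Let mY : measurable_fun setT Y. Proof. exact: measurable_snd. Qed.

Let integral_K (e e' : R) p : 0 < e -> 0 < e' ->
  (\int[leb2]_x (poisson e (X x - p.1) * poisson e' (Y x - p.2))%:E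
   = (pi ^+ 2)%:E)%E.
Proof.
move=> e0 e'0.
have m1 (s : R) (r : R) : 0 < r -> measurable_fun setT
  (fun x : measurableTypeR R => poisson r ((x : R) - s)).
  move=> r0; apply: (measurableT_comp (measurable_poisson r0)).
  by apply: measurable_funB => //; exact: measurable_id.
have inner (x : R) : (\int[@lebesgue_measure R]_y
    (poisson e (x - p.1) * poisson e' (y - p.2))%:E
    = pi%:E * (poisson e (x - p.1))%:E)%E.
  under eq_integral do rewrite EFinM.
  rewrite ge0_integralZl//.
  - by rewrite integral_poisson// muleC.
  - by apply/measurable_EFinP; exact: m1.
  - by move=> y _; rewrite lee_fin poisson_ge0.
  - by rewrite lee_fin poisson_ge0.
rewrite [LHS]fubini_tonelli1; last 2 first.
- apply/measurable_EFinP; apply: measurable_funM.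
    by apply: (measurableT_comp (m1 p.1 e e0)); exact: measurable_fst.
  by apply: (measurableT_comp (m1 p.2 e' e'0)); exact: measurable_snd.
- by move=> x; rewrite lee_fin mulr_ge0 ?poisson_ge0.
transitivity (\int[@lebesgue_measure R]_x (pi%:E * (poisson e (x - p.1))%:E))%E.
  by apply: eq_integral => x _; exact: inner.
rewrite ge0_integralZl//.
- by rewrite integral_poisson// expr2 EFinM.
- by apply/measurable_EFinP; exact: m1.
- by move=> x _; rewrite lee_fin poisson_ge0.
- by rewrite lee_fin pi_ge0.
Qed.

(** For complex a and b, Re(a conj b) - Re(a b) = 2 Im a Im b. With a and b the two resolvents, the
    imaginary parts are minus the Poisson kernels, and conjugating b amounts to conjugating w. *)
Let Rintegral_poisson_cauchy2 P (e x y : R) : 0 < e ->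
  \int[P]_p (poisson e (x - p.1) * poisson e (y - p.2))
  = (complex.Re (cauchy2 P (x +i* e) (y +i* (- e)))
     - complex.Re (cauchy2 P (x +i* e) (y +i* e))) / 2.
Proof.
move=> e0.
have nz (u : R) : nonreal (u +i* e) by rewrite /nonreal /= gt_eqF.
have nw (u : R) : nonreal (u +i* (- e)) by rewrite /nonreal /= oppr_eq0 gt_eqF.
have [i1 _] := Cintegrable_resolventM P measurable_fst measurable_snd (nz x)
  (nz y).
have [i2 _] := Cintegrable_resolventM P measurable_fst measurable_snd (nz x)
  (nw y).
have ReC h : complex.Re (Cintegral P h) = \int[P]_p complex.Re (h p) by [].
rewrite !cauchy2E !ReC -RintegralB// -RintegralZr//; last first.
  exact: (integrableB measurableT i2 i1).
apply: eq_Rintegral => p _.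
rewrite !cReM !(cReV, cImV) !(cReD, cImD, cReN, cImN) /= oppr0 !addr0 /poisson.
have n1 : (x - p.1) ^+ 2 + e ^+ 2 != 0 by rewrite gt_eqF// ltr_wpDl ?sqr_ge0//
  exprn_gt0.
have n2 : (y - p.2) ^+ 2 + e ^+ 2 != 0 by rewrite gt_eqF// ltr_wpDl ?sqr_ge0//
  exprn_gt0.
rewrite sqrrN; field.
by rewrite n1 n2.
Qed.

Lemma cvg_integral_compact_support (P : nat -> planar_probability R) P'
    (f : R * R -> R) (A B : R) :
  (forall z w, nonreal z -> nonreal w ->
    Ccvg (fun n => cauchy2 (P n) z w) (cauchy2 P' z w)) ->
  continuous f -> 0 <= B -> (forall p, `|f p| <= B) ->
  (forall p, f p != 0 -> `|p.1| <= A /\ `|p.2| <= A) ->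
  (fun n => \int[P n]_p f p) @ \oo --> \int[P']_p f p.
Proof.
move=> cP cf B0 fB f0.
apply: (@cvg_integral_of_cvg_poisson _ _ _ leb2 X Y mX mY integral_K f
  (B * (1 + A ^+ 2) ^+ 2)).
- exact: continuous_measurable_plane.
- by rewrite mulr_ge0// sqr_ge0.
- exact: plane_poisson_dominated.
- exact: (plane_poisson_modulus cf B0 fB f0).
move=> e x e0.
rewrite Rintegral_poisson_cauchy2// (_ : (fun n => _) = fun n =>
   (complex.Re (cauchy2 (P n) (X x +i* e) (Y x +i* (- e)))
    - complex.Re (cauchy2 (P n) (X x +i* e) (Y x +i* e))) / 2); last first.
  by apply/funext => n; rewrite Rintegral_poisson_cauchy2.
have nz (u : R) : nonreal (u +i* e) by rewrite /nonreal /= gt_eqF.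
have nw (u : R) : nonreal (u +i* (- e)) by rewrite /nonreal /= oppr_eq0 gt_eqF.
have [c1 _] := cP _ _ (nz (X x)) (nw (Y x)).
have [c2 _] := cP _ _ (nz (X x)) (nz (Y x)).
by apply: cvgM; [exact: cvgB|exact: cvg_cst].
Qed.

(** A trapezoid: 1 for |u| <= A - 1 and 0 for |u| >= A when A >= 1. *)
Let kappa (A u : R) : R := Num.max 0 (Num.min 1 (A - `|u|)).

Let kappa_ge0 A u : 0 <= kappa A u.
Proof. by rewrite /kappa le_max lexx. Qed.

Let kappa_le1 A u : kappa A u <= 1.
Proof. by rewrite /kappa ge_max ler01 ge_min lexx. Qed.

Let kappa_supp A u : kappa A u != 0 -> `|u| <= A.
Proof.
apply: contraNT; rewrite -ltNge => uA; apply/eqP/max_idPl.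
by rewrite ge_min subr_le0 (ltW uA) orbT.
Qed.

Let kappa_eq1 A u : `|u| + 1 <= A -> kappa A u = 1.
Proof.
move=> uA; rewrite /kappa (min_idPl _) ?(max_idPr _)//.
by rewrite lerBrDl.
Qed.

Let continuous_kappa A : continuous (kappa A).
Proof.
have c0 (k : R) : continuous (cst k : R -> R) by move=> u; exact: cvg_cst.
have cA : continuous (fun u : R => A - `|u|).
  by move=> u; apply: cvgB; [exact: cvg_cst|exact: norm_continuous].
exact: (max_fun_continuous (c0 0) (min_fun_continuous (c0 1) cA)).
Qed.

Let cutoff (A : R) p := kappa A p.1 * kappa A p.2.

Let cutoff_ge0 A p : 0 <= cutoff A p.
Proof. by rewrite mulr_ge0 ?kappa_ge0. Qed.

Let cutoff_le1 A p : cutoff A p <= 1.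
Proof. by rewrite -[leRHS]mulr1 ler_pM ?kappa_ge0 ?kappa_le1. Qed.

Let cutoff_supp A p : cutoff A p != 0 -> `|p.1| <= A /\ `|p.2| <= A.
Proof. by rewrite mulf_eq0 negb_or => /andP[/kappa_supp ? /kappa_supp ?]. Qed.

Let continuous_cutoff A : continuous (cutoff A).
Proof.
move=> p; apply: cvgM.
- by apply: (continuous_comp (@cvg_fst _ _ _ _ _)); exact: continuous_kappa.
- by apply: (continuous_comp (@cvg_snd _ _ _ _ _)); exact: continuous_kappa.
Qed.

Let integrable_cutoff P A : P.-integrable setT (EFin \o cutoff A).
Proof.
apply: (@integrable_bounded _ _ _ P _ 1).
  exact: continuous_measurable_plane.
by move=> p; rewrite ger0_norm.
Qed.

Let cvg_cutoff P : (fun n => \int[P]_p cutoff n%:R p) @ \oo --> (1 : R).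
Proof.
rewrite -[X in _ --> X](Rintegral_probability_cst P).
apply: (@Rintegral_dominated_cvg _ _ _ P _ _ (cst 1)).
- by move=> n; exact: continuous_measurable_plane.
- exact: measurable_cst.
- move=> p; apply: cvg_near_cst; near=> n.
  have k1 : `|p.1| + 1 <= n%:R by near: n; exact: nbhs_infty_ger.
  have k2 : `|p.2| + 1 <= n%:R by near: n; exact: nbhs_infty_ger.
  by rewrite /cutoff (kappa_eq1 k1) (kappa_eq1 k2) mulr1.
- exact: finite_measure_integrable_cst.
- by move=> n p; rewrite ger0_norm.
Unshelve. all: by end_near. Qed.

Lemma cvg_integral_bounded (P : nat -> planar_probability R) P'
  (f : R * R -> R) (M : R) :
  (forall z w, nonreal z -> nonreal w ->
    Ccvg (fun n => cauchy2 (P n) z w) (cauchy2 P' z w)) ->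
  continuous f -> (forall p, `|f p| <= M) ->
  (fun n => \int[P n]_p f p) @ \oo --> \int[P']_p f p.
Proof.
move=> cP cf fM.
have M0 : 0 <= M by rewrite (le_trans _ (fM (0, 0))).
apply/cvgrPdist_le => eps eps0.
(* The budget is eps/4 for the tail under P', twice that under [P n], and eps/4 for the truncated
   integrals; M + 1 avoids dividing by 0. *)
pose eta := eps / (4 * (M + 1)).
have eta0 : 0 < eta by rewrite divr_gt0// mulr_gt0// ltr_wpDl.
have etaM : M * eta <= eps / 4.
  have : eta * (4 * (M + 1)) = eps by rewrite divfK// gt_eqF// mulr_gt0//
    ltr_wpDl.
  by move: eta0; nra.
have [A hA] : exists A, 1 - \int[P']_p cutoff A p <= eta.
  have /cvgrPdist_le /(_ _ eta0)[n _ hn] := cvg_cutoff P'.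
  exists n%:R; rewrite (le_trans (ler_norm _))//; exact: (hn n (leqnn n)).
(* The lost mass 1 - cutoff is nonnegative and Q is a probability, so the tail is controlled by the
   integral of the cutoff alone. *)
have tail (Q : planar_probability R) : `|\int[Q]_p f p - \int[Q]_p
  (f p * cutoff A p)|
    <= M * (1 - \int[Q]_p cutoff A p).
  have if_ : Q.-integrable setT (EFin \o f).
    by apply: (@integrable_bounded _ _ _ Q f M) => //;
      exact: continuous_measurable_plane.
  have ifc : Q.-integrable setT (EFin \o (fun p => f p * cutoff A p)).
    apply: (@integrable_bounded _ _ _ Q _ M).
      by apply: measurable_funM; exact: continuous_measurable_plane.
    by move=> p; rewrite normrM (ger0_norm
      (cutoff_ge0 _ _)) -[leRHS]mulr1 ler_pM.
  have i1 : Q.-integrable setT (EFin \o (fun=> 1 : R)).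
    exact: finite_measure_integrable_cst.
  have i1c : Q.-integrable setT (EFin \o (fun p => 1 - cutoff A p)).
    exact: (integrableB measurableT i1 (integrable_cutoff Q A)).
  have id : Q.-integrable setT (EFin \o (fun p => f p - f p * cutoff A p)).
    exact: (integrableB measurableT if_ ifc).
  rewrite -RintegralB// (le_trans (le_normr_Rintegral measurableT id))//.
  rewrite -[X in X - _](Rintegral_probability_cst Q) -RintegralB//; last first.
    exact: integrable_cutoff.
  rewrite -RintegralZl//; apply: le_Rintegral => //.
  - exact: (integrable_norm id).
  - exact: (integrableZl measurableT M i1c).
  move=> p _; rewrite -[X in X - _]mulr1 -mulrBr normrM.
  by rewrite (ger0_norm (_ : 0 <= 1 - cutoff A p)) ?subr_ge0//
    ler_wpM2r ?subr_ge0.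
have cc : (fun n => \int[P n]_p cutoff A p) @ \oo --> \int[P']_p cutoff A p.
  apply: (@cvg_integral_compact_support _ _ _ A 1) => //.
  - by move=> p; rewrite ger0_norm.
  - by move=> p; exact: cutoff_supp.
have cfc : (fun n => \int[P n]_p (f p * cutoff A p)) @ \oo
    --> \int[P']_p (f p * cutoff A p).
  apply: (@cvg_integral_compact_support _ _ _ A M) => //.
  - by move=> p; apply: cvgM; [exact: cf|exact: continuous_cutoff].
  - move=> p; rewrite normrM (ger0_norm (cutoff_ge0 _ _)).
    by rewrite -[leRHS]mulr1 ler_pM.
  - by move=> p; rewrite mulf_eq0 negb_or => /andP[_ /cutoff_supp].
have eps4 : 0 < eps / 4 by rewrite divr_gt0.
near=> n.
have h1 : `|\int[P']_p cutoff A p - \int[P n]_p cutoff A p| <= eta.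
  by near: n; move/cvgrPdist_le : cc; exact.
have h2 : `|\int[P']_p (f p * cutoff A p)
    - \int[P n]_p (f p * cutoff A p)| <= eps / 4.
  by near: n; move/cvgrPdist_le : cfc; exact.
have t1 : `|\int[P']_p f p - \int[P']_p (f p * cutoff A p)| <= eps / 4.
  by rewrite (le_trans (tail P'))// (le_trans _ etaM)// ler_wpM2l.
have t2 : `|\int[P n]_p f p - \int[P n]_p (f p * cutoff A p)|
    <= eps / 4 + eps / 4.
  rewrite (le_trans (tail (P n)))// (@le_trans _ _ (M * (eta + eta)))//.
    rewrite ler_wpM2l// -(subrKA (\int[P']_p cutoff A p)) lerD//.
    exact: le_trans (ler_norm _) h1.
  by rewrite mulrDr lerD.
apply: le_trans (ler_dist4 t1 t2 h2) _.
by rewrite le_eqVlt; apply/orP; left; apply/eqP; field.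
Unshelve. all: by end_near. Qed.

End StieltjesInversion.

(** * Convolution powers as sequences with the Gaussian rate *)

Lemma gaussian_rate_power (R : realType) (c : R)
  (mu gamma : planar_probability R)
    (nu rho : nat -> planar_probability R) :
  standardized_third_moments c mu -> bi_boolean_gaussian c gamma ->
  (forall n, bi_boolean_power n mu (nu n) /\
      rho n = dilation (Num.sqrt n%:R)^-1 (nu n) \/ rho n = gamma) ->
  gaussian_rate c rho.
Proof.
move=> hmu hg hrho K K1; have [C C0 hC] := partial_self_energy_rate hmu K1.
exists C => // n z w n0 nz z2 zK nw w2 wK.
have [[hn ->]|->] := hrho n.
  by rewrite !opprD !addrA; exact: hC.
rewrite (hg z w nz nw) subrr Normc.normc0 mulr_ge0//.
  by rewrite divr_ge0 ?sqrtr_ge0// ltW.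
by apply: sumr_ge0 => k _; rewrite mulr_ge0// exprn_ge0// invr_ge0 normc_ge0.
Qed.

(* Off the set of indices where the convolution power exists, the sequence may
   be replaced by the constant [gamma]; this turns the restricted limit into an
   ordinary one. *)
Lemma weakly_cvg_power (R : realType) (c : R) (mu gamma : planar_probability R)
    (nu : nat -> planar_probability R) :
  standardized_third_moments c mu -> bi_boolean_gaussian c gamma ->
  weakly_cvg (within [set n | bi_boolean_power n mu (nu n)] \oo)
    (fun n => dilation (Num.sqrt n%:R)^-1 (nu n)) gamma.
Proof.
move=> hmu hg f cf [M fM].
pose rho n := if pselect (bi_boolean_power n mu (nu n))
  then dilation (Num.sqrt n%:R)^-1 (nu n) else gamma.
have rho_rate : gaussian_rate c rho.
  apply: (@gaussian_rate_power _ _ mu gamma nu) => // n.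
  by rewrite /rho; case: pselect => hn; [left|right].
have := cvg_integral_bounded (fun z w nz nw =>
  cauchy2_cvg hg rho_rate nz nw) cf fM.
move=> /cvgrPdist_le h; apply/cvgrPdist_le => e e0.
rewrite near_withinE; near=> n => hn.
have : `|\int[gamma]_p f p - \int[rho n]_p f p| <= e by near: n; exact: h.
by rewrite /rho; case: pselect.
Unshelve. all: by end_near. Qed.

(* In the second conclusion n tends to infinity through the integers for which
   nu n is the n-fold convolution of mu; when nu n is so for every n, this is
   convergence of the whole sequence. *)
Theorem theorem5p2 (R : realType) (alpha beta : R)
  (alpha_gt0 : 0 < alpha) (beta_gt0 : 0 < beta)
  (Delta_disc : stolz alpha beta `<=` stolz_disc)
  (c : R) (hc : -1 <= c <= 1)
  (mu : planar_probability R) (hmu : standardized_third_moments c mu)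
  (gamma : planar_probability R) (hgamma : bi_boolean_gaussian c gamma) :
  (exists2 C : R, 0 < C &
     forall (n : nat) (nu : planar_probability R),
       (1 <= n)%N -> bi_boolean_power n mu nu ->
       (dBB alpha beta (dilation (Num.sqrt n%:R)^-1 nu) gamma
        <= (C / Num.sqrt n%:R)%:E)%E)
  /\
  (forall nu : nat -> planar_probability R,
     weakly_cvg (within [set n | bi_boolean_power n mu (nu n)] \oo)
       (fun n => dilation (Num.sqrt n%:R)^-1 (nu n)) gamma).
Proof.
split; first exact: dBB_power_le hmu hgamma.
by move=> nu; exact: weakly_cvg_power hmu hgamma.
Qed.
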